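(* Let $\mathbf{E}$ be a finite set, $n\in\mathbb{N}$, $\mathsf{G}_{1},\ldots,\mathsf{G}_{n+1}$ be $|\mathbf{E}|\times|\mathbf{E}|$ matrices with non-negative off-diagonal entries and zero row sums, $v:\mathbf{E}\to\mathbb{R}\setminus\{0\}$, $\mathbf{E}^{\pm}=\{i:\pm v(i)>0\}$, and $c>0$. For $0<s_1<\cdots<s_n$, let $X$ be a time-inhomogeneous Markov chain on $\mathbf{E}$ (with $\mathbb{P}(X_0=i)>0$ for all $i$) with generator $\mathsf{G}_t=\mathsf{G}_k$ for $s_{k-1}\le t<s_k$ ($k=1,\ldots,n$, $s_0=0$) and $\mathsf{G}_t=\mathsf{G}_{n+1}$ for $t\ge s_n$; let $\varphi_t=\int_0^tv(X_u)du$, $\tau^+_t=\inf\{r\ge0:\varphi_r>t\}$, and $$\Pi^+_c(i,j;s_1,\ldots,s_n)=\mathbb{E}\big(e^{-c\tau_0^+}\mathbf{1}_{\{X_{\tau^+_0}=j\}}\mid X_0=i\big),\qquad \Psi^+_c(t,i,j;s_1,\ldots,s_n)=\mathbb{E}\big(e^{-c\tau_t^+}\mathbf{1}_{\{X_{\tau^+_t}=j\}}\mid X_0=i\big).$$ For $q_1,\ldots,q_n>0$, let $Z=(N,Y)$ be a time-homogeneous Markov chain on $\{0,\ldots,n\}\times\mathbf{E}$ with generator $\widetilde{\mathsf{G}}$ having diagonal blocks $\mathsf{G}_{k+1}-q_{k+1}\mathsf{I}$ on $\{k\}\times\mathbf{E}$ ($k<n$) and $\mathsf{G}_{n+1}$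 on $\{n\}\times\mathbf{E}$, blocks $q_{k+1}\mathsf{I}$ from $\{k\}\times\mathbf{E}$ to $\{k+1\}\times\mathbf{E}$, other blocks zero; let $\widetilde{\mathbb{E}}^{i}$ be expectation conditional on $Z_0=(0,i)$, $\widetilde{\varphi}_t=\int_0^t v(Y_u)du$, $\widetilde{\tau}^+_t=\inf\{r\ge0:\widetilde{\varphi}_r>t\}$, and define $$\widehat{\Pi}^+_c(i,j;q_1,\ldots,q_n)=\widetilde{\mathbb{E}}^{i}\big(e^{-c\widetilde{\tau}^+_0}\mathbf{1}_{\{Y_{\widetilde{\tau}^+_0}=j\}}\big),\qquad \widehat{\Psi}^+_c(t,i,j;q_1,\ldots,q_n)=\widetilde{\mathbb{E}}^{i}\big(e^{-c\widetilde{\tau}^+_t}\mathbf{1}_{\{Y_{\widetilde{\tau}^+_t}=j\}}\big).$$ Then for $i\in\mathbf{E}^-$, $j\in\mathbf{E}^+$, $$\Pi^+_c(i,j;s_1,\ldots,s_n)=\mathcal{L}^{-1}\Big(q_1^{-1}\cdots q_n^{-1}\widehat{\Pi}^+_c(i,j;q_1,\ldots,q_n)\Big)(s_1,s_2-s_1,\ldots,s_n-s_{n-1}),$$ and for any $t>0$ and $i,j\in\mathbf{E}^+$, $$\Psi^+_c(t,i,j;s_1,\ldots,s_n)=\mathcal{L}^{-1}\Big(q_1^{-1}\cdots q_n^{-1}\widehat{\Psi}^+_c(t,i,j;q_1,\ldots,q_n)\Big)(s_1,s_2-s_1,\ldots,s_n-s_{n-1}),$$ where $\mathcal{L}^{-1}$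 denotes the inverse multivariate Laplace transform (with respect to $(q_1,\ldots,q_n)$).
   Context: For a Borel function $f:[0,\infty)^n\to[0,\infty)$, its multivariate Laplace transform is $\mathcal{L}(f)(q_1,\ldots,q_n)=\int_{[0,\infty)^n}f(t_1,\ldots,t_n)\prod_k e^{-q_kt_k}\,dt_1\cdots dt_n$, defined for $\Re(q_k)>0$; the inverse multivariate Laplace transform $\mathcal{L}^{-1}(g)$ of a function $g$ is the function $\check g$ with $\mathcal{L}(\check g)=g$. *)

(* Defs.v *)
From HB Require Import structures.
From mathcomp Require Import all_boot all_order all_algebra.
From mathcomp Require Import all_classical all_reals all_analysis.
Set Implicit Arguments. Unset Strict Implicit. Unset Printing Implicit Defensive.
Import Order.TTheory GRing.Theory Num.Theory numFieldNormedType.Exports.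
Local Open Scope classical_set_scope.
Local Open Scope ring_scope.

Section Defs.
Context {R : realType}.

Definition mxf (S : finType) := S -> S -> R.
Definition idf {S : finType} : mxf S := fun i j => (i == j)%:R.
Definition mulf {S : finType} (A B : mxf S) : mxf S :=
  fun i j => \sum_k A i k * B k j.
Definition scalef {S : finType} (a : R) (A : mxf S) : mxf S :=
  fun i j => a * A i j.
Definition expf {S : finType} (A : mxf S) : mxf S := fun i j =>
  lim ((fun N : nat =>
    iter N.+1 (mulf (fun a b => idf a b + A a b / N.+1%:R)) idf i j) @ \oo).

Definition is_generator {S : finType} (A : mxf S) : Prop :=
  (forall i j, i != j -> 0 <= A i j) /\ (forall i, \sum_j A i j = 0).

(* piecewise generator: G k on [s_{k-1}, s_k) (0-indexed), G nb on [s_{nb-1}, oo) *)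
Definition genAt {S : finType} {nb : nat} (s : 'I_nb -> R)
  (G : 'I_nb.+1 -> mxf S) (t : R) : mxf S :=
  G (inord #|[pred k : 'I_nb | s k <= t]|).

Definition no_brk {nb : nat} (s : 'I_nb -> R) (a b : R) : Prop :=
  forall k, ~ (a < s k < b).

Definition rc_path {S : Type} (x : R -> S) : Prop :=
  forall t, 0 <= t -> exists2 e : R, 0 < e & forall u, t <= u < t + e -> x u = x t.

Definition markov_chain {d} {T : measurableType d} {S : finType} {nb : nat}
  (P : probability T R) (X : R -> T -> S) (s : 'I_nb -> R)
  (G : 'I_nb.+1 -> mxf S) : Prop :=
  [/\ forall t i, 0 <= t -> measurable [set w | X t w = i],
      forall w, rc_path (fun t => X t w) &
      forall (K : nat) (tt : nat -> R) (ii : nat -> S), tt 0%N = 0 ->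
        (forall k, (k < K)%N -> tt k < tt k.+1 /\ no_brk s (tt k) (tt k.+1)) ->
        P [set w | forall k, (k <= K)%N -> X (tt k) w = ii k] =
        (P [set w | X 0%R w = ii 0%N] *
          (\prod_(k < K) expf (scalef (tt k.+1 - tt k) (genAt s G (tt k)))
                          (ii k) (ii k.+1))%:E)%E].

Definition phi {S : Type} (v : S -> R) (x : R -> S) (r : R) : R :=
  Rintegral lebesgue_measure `[0, r] (fun u => v (x u)).

Definition tau_plus {S : Type} (v : S -> R) (x : R -> S) (t : R) : \bar R :=
  ereal_inf [set r%:E | r in [set r : R | 0 <= r /\ t < phi v x r]].

Definition disc {S : eqType} (c : R) (v : S -> R) (x : R -> S) (t : R) (j : S) : R :=
  match tau_plus v x t with
  | EFin r => expR (- (c * r)) * (x r == j)%:R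
  | _ => 0
  end.

Definition condE {d} {T : measurableType d} (P : probability T R)
  (A : set T) (f : T -> R) : R :=
  fine (\int[P]_(w in A) (f w)%:E) / fine (P A).

Fixpoint iint (k : nat) (F : seq R -> \bar R) : \bar R :=
  match k with
  | 0%N => F [::]
  | k'.+1 => (\int[lebesgue_measure]_(x in [set x : R | (0 < x)%R]) iint k' (fun l => F (x :: l)))%E
  end.

(* g is the multivariate Laplace transform of f (f is an inverse Laplace
   transform of g) *)
Definition laplace_eq {n : nat} (f g : ('I_n -> R) -> R) : Prop :=
  forall q : 'I_n -> R, (forall k, 0 < q k) ->
    iint n (fun l => (f (fun k => nth 0 l k) *
                      expR (- \sum_k q k * nth 0 l k))%:E) = (g q)%:E.

Definition incr_pos {n : nat} (s : 'I_n -> R) : Prop :=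
  (forall k, 0 < s k) /\ (forall k l : 'I_n, (k < l)%N -> s k < s l).

Definition cumsum {n : nat} (u : 'I_n -> R) : 'I_n -> R :=
  fun k => \sum_(j < n | (j <= k)%N) u j.

Definition qat {n : nat} (q : 'I_n -> R) (k : nat) : R :=
  oapp q 0 (insub k : option 'I_n).

Definition tgen {S : finType} {n : nat} (G : 'I_n.+1 -> mxf S) (q : 'I_n -> R)
  : mxf ('I_n.+1 * S)%type := fun a b =>
  if a.1 == b.1 then G a.1 a.2 b.2 - qat q a.1 * (a.2 == b.2)%:R
  else if (b.1 : nat) == (a.1).+1 then qat q a.1 * (a.2 == b.2)%:R else 0.

End Defs.

(* Main.v *)
(** The law of [Y] started from [(0, i)] is the mixture of the laws of the chains [X]
    with breaks [u_1, u_1 + u_2, ...], where the [u_k] are independent exponential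
    variables of rates [q_k].  For finite-dimensional distributions this is an
    induction on the number of levels and of observations: splitting the integral
    over the first gap [u] at the first observation time [d], the part [u > d]
    factors by the lack of memory, and the part [u < d] is Duhamel's formula for the
    block triangular matrix exponential of the generator of [Z].
    For right-continuous paths the discounted first-passage functional is an iterated
    pointwise limit of bounded cylinder functionals: replace the passage time by the
    first point of a grid where [phi > t], the indicator of [phi > t] by a continuous
    function of [phi], and [phi] by a Riemann sum.  Dominated convergence transfers
    the mixture identity to the limit; the Laplace transform is this mixture with the
    densities [e^{-q_k u_k}] instead of [q_k e^{-q_k u_k}]. *)

From Pilot Require Import Defs.
From HB Require Import structures.
From mathcomp Require Import all_boot all_order all_algebra.
From mathcomp Require Import all_classical all_reals all_analysis.
From mathcomp Require Import measurable_realfun ring lra.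
Import Pilot.Defs. (* MathComp also exports a [mulf] *)
Import Order.TTheory GRing.Theory Num.Theory numFieldNormedType.Exports.
Local Open Scope classical_set_scope.
Local Open Scope ring_scope.
Set Implicit Arguments.
Unset Strict Implicit.
Unset Printing Implicit Defensive.

(** * Matrix exponentials *)

(** The chains [X s] live on unrelated probability spaces, one for each [s], and no hypothesis says
    that their laws depend measurably on [s]. So no coupling of [Z] with the [X s] is built: the
    mixture identity is an equality of numbers for each functional, and measurability in the gaps is
    proved along with it, from explicit formulas for cylinder functionals and then through every
    limit. The order of the limits is dictated by continuity: Riemann sums converge to [phi], but
    the indicator of [phi > t] is discontinuous at [t], so it is smoothed before [phi] is
    discretised. Right-continuity is used twice: right-endpoint Riemann sums converge, and the path
    is constant just after the passage time, so that the first grid point beyond it sees the correct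
    state. *)

Section matrix_exponential.
Context {R : realType} {S : finType}.
Implicit Types (A B C : @mxf R S) (i j : S) (k N : nat) (t h : R).

Lemma mulfA A B C : mulf A (mulf B C) = mulf (mulf A B) C.
Proof.
apply/funext => i; apply/funext => j; rewrite /mulf.
under eq_bigr do rewrite mulr_sumr.
rewrite exchange_big; apply: eq_bigr => l _; rewrite mulr_suml.
by apply: eq_bigr => m _; rewrite mulrA.
Qed.

Lemma sum_idf (F : S -> R) i : \sum_l idf i l * F l = F i.
Proof.
rewrite (bigD1 i)//= /idf eqxx mul1r big1 ?addr0// => l li.
by rewrite eq_sym (negbTE li) mul0r.
Qed.

Lemma mul1f A : mulf idf A = A.
Proof. by apply/funext => i; apply/funext => j; rewrite /mulf sum_idf. Qed.

Lemma mulf1 A : mulf A idf = A.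
Proof.
apply/funext => i; apply/funext => j; rewrite /mulf (bigD1 j)//= /idf eqxx mulr1.
by rewrite big1 ?addr0// => k ki; rewrite (negbTE ki) mulr0.
Qed.

Definition powf A k : mxf S := iter k (mulf A) idf.

Lemma powfS A k : powf A k.+1 = mulf A (powf A k). Proof. by []. Qed.

Lemma powfSr A k : powf A k.+1 = mulf (powf A k) A.
Proof.
elim: k => [|k IH]; first by rewrite powfS mulf1 mul1f.
by rewrite powfS {1}IH mulfA -powfS.
Qed.

Lemma powf_scalef t A k i j : powf (scalef t A) k i j = t ^+ k * powf A k i j.
Proof.
elim: k i j => [|k IH] i j; first by rewrite expr0 mul1r.
rewrite !powfS /mulf mulr_sumr; apply: eq_bigr => l _.
by rewrite IH /scalef exprS; ring.
Qed.

Definition normf A : R := \sum_i \sum_j `|A i j|.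

Lemma normf_ge0 A : 0 <= normf A.
Proof. by apply: sumr_ge0 => i _; apply: sumr_ge0. Qed.

Lemma powf_le A k i j : `|powf A k i j| <= normf A ^+ k.
Proof.
elim: k i j => [|k IH] i j.
  by rewrite /powf/= /idf expr0; case: eqP; rewrite ?normr1 ?normr0.
rewrite powfS /mulf exprS (le_trans (ler_norm_sum _ _ _))//.
apply: (@le_trans _ _ (\sum_l `|A i l| * normf A ^+ k)).
  by apply: ler_sum => l _; rewrite normrM ler_wpM2l.
rewrite -mulr_suml ler_wpM2r ?exprn_ge0 ?normf_ge0//.
by rewrite /normf [leRHS](bigD1 i)//= lerDl sumr_ge0// => l _; apply: sumr_ge0.
Qed.

(** Binomial theorem for the commuting matrices [idf] and [h A]; the induction step is Pascal's
    rule. It exposes the coefficients to be compared with those of the exponential series. *)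
Lemma iter_euler A h N i j :
  iter N (mulf (fun a b => idf a b + h * A a b)) idf i j =
  \sum_(k < N.+1) h ^+ k *+ 'C(N, k) * powf A k i j.
Proof.
elim: N i j => [|N IH] i j.
  by rewrite big_ord1 /= bin0 expr0 mulr1n mul1r.
rewrite iterS {1}/mulf.
under eq_bigr do rewrite IH mulrDl.
rewrite big_split/= big_ord_recl /= bin0 expr0 mulr1n mul1r.
under [in RHS]eq_bigr do rewrite /bump/= add1n binS mulrnDr mulrDl.
rewrite big_split/= addrA; congr (_ + _).
  rewrite big_ord_recr/= bin_small// mulr0n mul0r addr0.
  rewrite sum_idf.
  rewrite big_ord_recl/= bin0 expr0 mulr1n mul1r; congr (_ + _).
under eq_bigr do rewrite mulr_sumr.
rewrite exchange_big/=; apply: eq_bigr => k _; rewrite /mulf mulr_sumr.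
apply: eq_bigr => l _; rewrite mulrnAl mulrnAr [in RHS]mulrnAl exprS.
by congr (_ *+ _); ring.
Qed.

(** Both bounds come from [1 + x <= expR x]: at [M / n] it gives the upper one, and at
    [- M / (n + M)] the lower one, because [1 - M / (n + M)] is the inverse of [1 + M / n]. *)
Lemma euler_cvg_expR (M : R) : 0 <= M ->
  (fun N => (1 + N.+1%:R^-1 * M) ^+ N.+1) @ \oo --> expR M.
Proof.
move=> M0.
apply: (@squeeze_cvgr _ _ _ _ (fun N => expR (M - M ^+ 2 / N.+1%:R)) (fun=> expR M)).
- apply: nearW => N; set n : R := N.+1%:R.
  have n0 : 0 < n by rewrite ltr0n.
  have expRn x : expR (n * x) = expR x ^+ N.+1 by rewrite expRM_natl.
  move: n n0 expRn => n n0 expRn.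
  have nM : 0 < n + M by rewrite ltr_wpDr.
  have e1 : 1 + n^-1 * M = (1 - M / (n + M))^-1.
    have -> : 1 - M / (n + M) = n / (n + M) by field; rewrite lt0r_neq0.
    by rewrite invf_div; field; rewrite lt0r_neq0.
  apply/andP; split; last first.
    rewrite -[leRHS](_ : expR (n^-1 * M) ^+ N.+1 = _).
      by rewrite lerXn2r ?nnegrE ?expR_ge0 ?expR_ge1Dx// addr_ge0// mulr_ge0// invr_ge0 ltW.
    by rewrite -expRn mulrA mulfV ?gt_eqF// mul1r.
  apply: (@le_trans _ _ (expR (M / (n + M)) ^+ N.+1)).
    rewrite -expRn ler_expR -subr_ge0.
    have -> : n * (M / (n + M)) - (M - M ^+ 2 / n) = M ^+ 3 / (n * (n + M)).
      by field; rewrite !lt0r_neq0.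
    by rewrite divr_ge0 ?exprn_ge0// mulr_ge0 // ltW.
  rewrite lerXn2r ?nnegrE ?expR_ge0//.
    by rewrite addr_ge0// mulr_ge0// invr_ge0 ltW.
  rewrite e1 -[leLHS]invrK lef_pV2 ?posrE ?invr_gt0 ?expR_gt0//.
    by rewrite -expRN expR_ge1Dx.
  rewrite subr_gt0 ltr_pdivrMr// mul1r; lra.
- rewrite -[X in _ --> expR X]subr0.
  apply: continuous_cvg; first exact: continuous_expR.
  apply: cvgB; first exact: cvg_cst.
  rewrite -[X in _ --> X](mulr0 (M ^+ 2)).
  by apply: cvgM; [exact: cvg_cst | exact: cvg_harmonic].
- exact: cvg_cst.
Qed.

End matrix_exponential.
Arguments powf {R S} A k : simpl never.

Lemma is_cvg_pseries_fact {R : realType} (u : R^nat) (a M t : R) : 0 <= M ->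
  (forall k, `|u k| <= a * M ^+ k) ->
  cvgn (pseries (fun k => u k / k`!%:R) t).
Proof.
move=> M0 uM; have a0 : 0 <= a by have := uM 0%N; rewrite mulr1; apply: le_trans.
apply: normed_cvg; apply: (@series_le_cvg _ _ (a *: exp_coeff (M * `|t|))).
- by move=> k /=.
- move=> k; rewrite /exp_coeff/= mulr_ge0//.
  by rewrite divr_ge0 ?exprn_ge0 ?mulr_ge0.
- move=> k; rewrite /exp_coeff/= normrM normf_div normrX.
  rewrite (ger0_norm (ler0n _ _)).
  rewrite [leRHS](_ : _ = a * M ^+ k / k`!%:R * `|t| ^+ k); last first.
    transitivity (a * ((M * `|t|) ^+ k / k`!%:R)) => //.
    by rewrite exprMn -[RHS]mulrA [_^-1 * _]mulrC !mulrA.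
  by rewrite ler_wpM2r ?exprn_ge0// ler_wpM2r ?invr_ge0.
- exact/is_cvg_seriesZ/is_cvg_series_exp_coeff.
Qed.

Lemma cvg_fsum {R : realType} {S : finType} {T} {F : set_system T} {FF : Filter F}
    (f : S -> T -> R) (a : S -> R) : (forall i, f i @ F --> a i) ->
  (fun t => \sum_i f i t) @ F --> \sum_i a i.
Proof.
move=> fa; rewrite -fct_sumE.
elim/big_ind2 : _ => [|x x' y y' hx hy|i _]; [exact: cvg_cst|exact: cvgD|exact: fa].
Qed.

Lemma pseries_fsum {R : realType} {S : finType} (c : S -> R^nat) (a : S -> R) t :
  (forall l, cvgn (pseries (c l) t)) ->
  limn (pseries (fun k => \sum_l a l * c l k) t) =
  \sum_l a l * limn (pseries (c l) t).
Proof.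
move=> cl; apply/cvg_lim => //.
rewrite (_ : pseries _ t = fun K => \sum_l a l * pseries (c l) t K).
  by apply: cvg_fsum => l; apply: cvgM; [exact: cvg_cst|exact: cl].
apply/funext => K; rewrite /pseries/series/=.
under [RHS]eq_bigr do rewrite mulr_sumr.
rewrite exchange_big/=; apply: eq_bigr => k _.
by rewrite mulr_suml; apply: eq_bigr => l _; rewrite mulrA.
Qed.

Lemma bin_div_le {R : realType} N k :
  'C(N.+1, k)%:R / N.+1%:R ^+ k <= (k`!%:R)^-1 :> R.
Proof.
have fa m p : (m ^_ p <= m ^ p)%N.
  elim: p m => [|p IH] [|m] //.
  rewrite ffactSS expnS leq_mul// (leq_trans (IH _))//.
  by case: p {IH} => // p; rewrite leq_exp2r.
rewrite ler_pdivrMr ?exprn_gt0 ?ltr0n// mulrC ler_pdivlMr ?ltr0n ?fact_gt0//.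
by rewrite -natrX -natrM ler_nat bin_ffact.
Qed.

(** * The Euler limit as a power series: Kolmogorov equations and stochasticity *)

Section matrix_exponential_series.
Context {R : realType} {S : finType}.
Implicit Types (A B C : @mxf R S) (i j : S) (k N : nat) (t h : R).

Definition expf_coef A i j : R^nat := fun k => powf A k i j / k`!%:R.

Lemma is_cvg_expf_coef A i j t : cvgn (pseries (expf_coef A i j) t).
Proof.
apply: (@is_cvg_pseries_fact _ _ 1 (normf A)); first exact: normf_ge0.
by move=> k; rewrite mul1r powf_le.
Qed.

(* Both sides are power series in [A] with coefficients [1 / k!] and
   [C(N+1, k) / (N+1)^k <= 1 / k!], so the difference is largest for [A] replaced by its norm. *)
Lemma euler_dist A i j N :
  `|limn (pseries (expf_coef A i j) 1) -
    iter N.+1 (mulf (fun a b => idf a b + A a b / N.+1%:R)) idf i j| <=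
  expR (normf A) - (1 + N.+1%:R^-1 * normf A) ^+ N.+1.
Proof.
set n : R := N.+1%:R; set M := normf A.
pose b k : R := 'C(N.+1, k)%:R / n ^+ k.
have trunc (u : R^nat) K : (N.+2 <= K)%N ->
    \sum_(k < N.+2) b k * u k = \sum_(0 <= k < K) b k * u k.
  move=> NK; rewrite (big_cat_nat (n := N.+2))//= big_mkord [X in _ + X]big1_seq ?addr0//.
  move=> k; rewrite mem_index_iota => /andP[_ /andP[Nk _]].
  by rewrite /b bin_small// !mul0r.
have -> : iter N.+1 (mulf (fun a b => idf a b + A a b / n)) idf i j =
    \sum_(k < N.+2) b k * powf A k i j.
  rewrite (_ : (fun a b => _) = (fun a b => idf a b + n^-1 * A a b)); last first.
    by apply/funext => x; apply/funext => y; rewrite mulrC.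
  rewrite iter_euler; apply: eq_bigr => k _; congr (_ * _).
  by rewrite /b -mulr_natl exprVn.
have -> : (1 + n^-1 * M) ^+ N.+1 = \sum_(k < N.+2) b k * M ^+ k.
  rewrite exprDn; apply: eq_bigr => k _.
  by rewrite expr1n mul1r exprMn /b -mulr_natl exprVn mulrA.
have cP : (fun K => `|pseries (expf_coef A i j) 1 K - \sum_(k < N.+2) b k * powf A k i j|)
    @ \oo --> `|limn (pseries (expf_coef A i j) 1) - \sum_(k < N.+2) b k * powf A k i j|.
  suff : (fun K => pseries (expf_coef A i j) 1 K - \sum_(k < N.+2) b k * powf A k i j)
      @ \oo --> limn (pseries (expf_coef A i j) 1) - \sum_(k < N.+2) b k * powf A k i j.
    exact: cvg_norm.
  by apply: cvgB; [exact: is_cvg_expf_coef|exact: cvg_cst].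
have cM : (fun K => series (exp_coeff M) K - \sum_(k < N.+2) b k * M ^+ k)
    @ \oo --> expR M - \sum_(k < N.+2) b k * M ^+ k.
  by apply: cvgB; [exact: is_cvg_series_exp_coeff|exact: cvg_cst].
apply: (ler_cvg_to cP cM).
exists N.+2 => // K /= NK; rewrite (trunc (fun k => powf A k i j) _ NK) (trunc (fun k => M ^+ k) _ NK).
rewrite /pseries/series/= -!sumrB (le_trans (ler_norm_sum _ _ _))//.
apply: ler_sum => k _; rewrite expr1n mulr1 /expf_coef /exp_coeff/=.
rewrite ![_ / k`!%:R]mulrC -!mulrBl normrM.
have bk : 0 <= k`!%:R^-1 - b k by rewrite subr_ge0 bin_div_le.
by rewrite (ger0_norm bk) ler_wpM2l// powf_le.
Qed.

Lemma cvg_euler A i j :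
  (fun N : nat => iter N.+1 (mulf (fun a b => idf a b + A a b / N.+1%:R)) idf i j)
    @ \oo --> limn (pseries (expf_coef A i j) 1).
Proof.
have b0 : (fun N => expR (normf A) - (1 + N.+1%:R^-1 * normf A) ^+ N.+1) @ \oo --> (0 : R).
  rewrite -(subrr (expR (normf A))); apply: cvgB; first exact: cvg_cst.
  by apply: euler_cvg_expR; exact: normf_ge0.
apply/cvgrPdist_le => e e0.
by apply: filterS (cvgr_le _ b0 _ e0) => N; apply: le_trans; exact: euler_dist.
Qed.

Lemma expfE A i j : expf A i j = limn (pseries (expf_coef A i j) 1).
Proof. exact/cvg_lim/cvg_euler. Qed.

Lemma expf_scaleE A t i j :
  expf (scalef t A) i j = limn (pseries (expf_coef A i j) t).
Proof.
rewrite expfE; congr (limn _); apply/funext => K; rewrite /pseries/series/=.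
apply: eq_bigr => k _; rewrite /expf_coef powf_scalef expr1n mulr1.
by rewrite -mulrA mulrC.
Qed.

Lemma pseries_diffs_fact (u : R^nat) :
  pseries_diffs (fun k => u k / k`!%:R) = fun k => u k.+1 / k`!%:R.
Proof.
by apply/funext => k; rewrite /pseries_diffs factS natrM invfM mulrCA mulVKf.
Qed.

Lemma is_derive_expf A i j t :
  is_derive t 1 (fun t => expf (scalef t A) i j)
    (limn (pseries (fun k => powf A k.+1 i j / k`!%:R) t)).
Proof.
rewrite (_ : (fun t => _) = fun t => limn (pseries (expf_coef A i j) t)); last first.
  by apply/funext => x; rewrite expf_scaleE.
have cv m K : cvgn (pseries (fun k => powf A (m + k) i j / k`!%:R) K).
  apply: (@is_cvg_pseries_fact _ _ (normf A ^+ m) (normf A)); first exact: normf_ge0.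
  by move=> k; rewrite -exprD powf_le.
(* Termwise differentiation needs convergence at some point beyond [|t|], for the series and its
   first two formal derivatives; [|t| + 1] is one such point. *)
have := @pseries_snd_diffs R (expf_coef A i j) (`|t| + 1) t.
rewrite /expf_coef !pseries_diffs_fact; apply.
- exact: (cv 0%N).
- exact: (cv 1%N).
- exact: (cv 2%N).
- by rewrite [X in _ < X]ger0_norm ?addr_ge0// ltrDl.
Qed.

(** The backward equation serves to differentiate [zobs] in its first time; the forward equation
    [is_derive_expf_right] serves for the motion before the jump in Duhamel's formula. *)
Lemma is_derive_expf_left A i j t :
  is_derive t 1 (fun t => expf (scalef t A) i j)
    (\sum_l A i l * expf (scalef t A) l j).
Proof.
under eq_bigr do rewrite expf_scaleE.
rewrite -(@pseries_fsum _ _ (fun l => expf_coef A l j)); last first.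
  by move=> l; exact: is_cvg_expf_coef.
rewrite (_ : (fun k => _) = fun k => powf A k.+1 i j / k`!%:R).
  exact: is_derive_expf.
apply/funext => k; rewrite powfS /mulf mulr_suml.
by apply: eq_bigr => l _; rewrite mulrA.
Qed.

Lemma is_derive_expf_right A i j t :
  is_derive t 1 (fun t => expf (scalef t A) i j)
    (\sum_l expf (scalef t A) i l * A l j).
Proof.
under eq_bigr do rewrite expf_scaleE mulrC.
rewrite -(@pseries_fsum _ _ (fun l => expf_coef A i l)); last first.
  by move=> l; exact: is_cvg_expf_coef.
rewrite (_ : (fun k => _) = fun k => powf A k.+1 i j / k`!%:R).
  exact: is_derive_expf.
apply/funext => k; rewrite powfSr /mulf mulr_suml.
by apply: eq_bigr => l _; rewrite mulrA [A l j * _]mulrC.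
Qed.

Lemma continuous_expf A i j : continuous (fun t => expf (scalef t A) i j).
Proof.
move=> t; apply/differentiable_continuous/derivable1_diffP.
by have [] := is_derive_expf A i j t.
Qed.

Lemma expf0 A i j : expf (scalef 0 A) i j = idf i j.
Proof.
rewrite expf_scaleE; apply: cvg_lim => //.
rewrite -cvg_shiftS/=; apply: (cvg_trans _ (@cvg_cst _ (idf i j) _ \oo _)).
apply: near_eq_cvg; apply: nearW => K.
rewrite /pseries/series/= big_nat_recl//= expr0 mulr1 /expf_coef fact0 divr1.
by rewrite big1 ?addr0// => k _; rewrite expr0n mulr0.
Qed.

Lemma sum_idf1 i : \sum_j idf i j = 1 :> R.
Proof.
by rewrite -[RHS](sum_idf (fun=> 1) i); apply: eq_bigr => j _; rewrite mulr1.
Qed.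

(** The terms of the power series have no sign, but the Euler factors do: as soon as [N.+1]
    dominates the diagonal, [I + A / N.+1] is a stochastic matrix, and so are its powers. Their
    limit inherits this in [expf_stoch]. *)
Lemma iter_euler_stoch A N : is_generator A -> normf A <= N.+1%:R -> forall k,
  let Y := iter k (mulf (fun a b => idf a b + A a b / N.+1%:R)) idf in
  (forall i j, 0 <= Y i j) /\ forall i, \sum_j Y i j = 1.
Proof.
move=> [A0 A1] AN; elim=> [|k [Y0 Y1]] /=.
  split=> [i j|i]; first by rewrite /idf.
  exact: sum_idf1.
have n0 : 0 < N.+1%:R :> R by rewrite ltr0n.
split=> [i j|i]; rewrite /mulf.
  apply: sumr_ge0 => l _; apply: mulr_ge0; last exact: Y0.
  have [<-|il] := eqVneq i l; last by rewrite /idf (negbTE il) add0r divr_ge0 ?A0 ?ler0n.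
  rewrite /idf eqxx addrC -lerBlDr sub0r ler_pdivlMr// mulN1r.
  have : `|A i i| <= N.+1%:R.
    apply: le_trans AN; rewrite /normf (bigD1 i)//= (bigD1 i)//= -addrA lerDl.
    by rewrite addr_ge0 ?sumr_ge0// => m _; rewrite sumr_ge0.
  by rewrite ler_norml => /andP[].
rewrite exchange_big/=; under eq_bigr do rewrite -mulr_sumr Y1 mulr1.
by rewrite big_split/= -mulr_suml A1 mul0r addr0 sum_idf1.
Qed.

Lemma expf_stoch A : is_generator A ->
  (forall i j, 0 <= expf A i j) /\ forall i, \sum_j expf A i j = 1.
Proof.
move=> gA.
have near_stoch : \forall N \near \oo, normf A <= N.+1%:R.
  near=> N; apply: (@le_trans _ _ N%:R); last by rewrite ler_nat.
  by near: N; exact: nbhs_infty_ger.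
split=> [i j|i].
  rewrite expfE; apply: (cvgr_to_ge (@cvg_euler A i j)).
  by apply: filterS near_stoch => N AN; have [/(_ i j)] := iter_euler_stoch gA AN N.+1.
have cY := cvg_fsum (fun j => @cvg_euler A i j).
under eq_bigr do rewrite expfE.
rewrite -(cvg_lim _ (cY _))//; apply: lim_near_cst => //.
by apply: filterS near_stoch => N AN; have [_ /(_ i)] := iter_euler_stoch gA AN N.+1.
Unshelve. all: by end_near. Qed.

End matrix_exponential_series.

(** * Iterated means over exponential variables *)

Section exponential_mean.
Context {R : realType}.
Local Notation mu := (@lebesgue_measure R).
Local Notation pos := [set x : R | 0 < x].
Implicit Types (q x M I : R) (qs l : seq R) (f g : seq R -> R).

Lemma pos_itv : pos = `]0, +oo[%classic.
Proof. by apply/seteqP; split => x /=; rewrite in_itv/= andbT. Qed.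

Lemma measurable_pos : measurable (pos : set R).
Proof. by rewrite pos_itv; exact: measurable_itv. Qed.

#[local] Hint Resolve measurable_pos : core.

Definition exp_int q (J : R -> R) : \bar R :=
  (\int[mu]_(x in pos) (q * expR (- (q * x)) * J x)%:E)%E.

Lemma measurable_expq q (D : set R) : measurable_fun D (fun x => q * expR (- (q * x))).
Proof.
apply: measurable_funM; first exact: measurable_cst.
apply: measurableT_comp; first exact: measurable_expR.
apply: measurableT_comp; first exact: oppr_measurable.
by apply: measurable_funM; [exact: measurable_cst|exact: measurable_id].
Qed.

Lemma measurable_exp_int q (J : R -> R) D : measurable_fun D J ->
  measurable_fun D (fun x => (q * expR (- (q * x)) * J x)%:E).
Proof.
by move=> mJ; apply/measurable_EFinP/measurable_funM => //; exact: measurable_expq.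
Qed.

Lemma exp_int_cst q M : 0 < q -> 0 <= M -> exp_int q (fun=> M) = M%:E.
Proof.
move=> q0 M0; rewrite /exp_int.
have me D : measurable_fun D (fun x => (q * expR (- (q * x)))%:E).
  by apply/measurable_EFinP; exact: measurable_expq.
under eq_integral do rewrite mulrC EFinM.
rewrite ge0_integralZl//=; last 2 first.
  exact: me.
  by move=> x _; rewrite lee_fin mulr_ge0 ?expR_ge0// ltW.
rewrite -[RHS]mule1 -(@integral_exponential_pdf R q)//; congr (_ * _)%E.
rewrite pos_itv integral_itv_obnd_cbnd// [LHS]integral_mkcond.
apply: eq_integral => x _; rewrite /exponential_pdf !patchE.
by case: ifP => // _; rewrite mulNr.
Qed.

Lemma exp_int_ge0 q J : 0 < q -> (forall x, 0 < x -> 0 <= J x) -> (0 <= exp_int q J)%E.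
Proof.
move=> q0 J0; apply: integral_ge0 => x x0.
by rewrite lee_fin !mulr_ge0 ?expR_ge0 ?J0// ltW.
Qed.

Lemma le_exp_int q (J K : R -> R) : 0 < q -> measurable_fun pos J -> measurable_fun pos K ->
  (forall x, 0 < x -> 0 <= J x <= K x) -> (exp_int q J <= exp_int q K)%E.
Proof.
move=> q0 mJ mK JK; apply: ge0_le_integral => //.
- move=> x /JK/andP[J0 _]; rewrite lee_fin !mulr_ge0 ?expR_ge0 ?J0//; exact: ltW.
- exact: measurable_exp_int.
- exact: measurable_exp_int.
- move=> x /JK/andP[_ JKx]; rewrite lee_fin ler_wpM2l// mulr_ge0 ?expR_ge0//; exact: ltW.
Qed.

(* [exp_mean qs f I]: [I] is the mean of [f [:: x_1; ...; x_n]] for independent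
   exponential variables [x_k] of rates [qs_k], with every partial mean measurable
   in the next variable, so that no product sigma-algebra is involved. *)
Fixpoint exp_mean qs f I : Prop :=
  match qs with
  | [::] => f [::] = I
  | q :: qs' => exists J : R -> R,
    [/\ forall x, 0 < x -> exp_mean qs' (fun l => f (x :: l)) (J x),
        measurable_fun pos J,
        exists M, forall x, 0 < x -> 0 <= J x <= M &
        exp_int q J = I%:E]
  end.

Definition pos_list qs l := (size l == size qs) && all (fun x => 0 < x) l.

Lemma pos_list_cons q qs x l :
  pos_list (q :: qs) (x :: l) = (0 < x) && pos_list qs l.
Proof. by rewrite /pos_list/= eqSS andbCA. Qed.

Lemma eq_exp_mean qs f g I : (forall l, pos_list qs l -> f l = g l) ->
  exp_mean qs f I -> exp_mean qs g I.
Proof.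
elim: qs f g I => [|q qs IH] f g I fg /=; first by rewrite -fg.
move=> [J [fJ mJ JM JI]]; exists J; split => // x x0.
by apply: IH (fJ _ x0) => l ql; rewrite fg// pos_list_cons x0.
Qed.

(** The bound inside [exp_mean] is only existential and may change with the functional; this one
    depends on [f] alone, which makes it uniform along a sequence, as dominated convergence
    requires. *)
Lemma exp_mean_bound qs f I M : all (fun x => 0 < x) qs ->
  (forall l, pos_list qs l -> 0 <= f l <= M) -> exp_mean qs f I -> 0 <= I <= M.
Proof.
elim: qs f I => [|q qs IH] f I /=; first by move=> _ fM <-; exact: fM.
move=> /andP[q0 qs0] fM [J [fJ mJ _ JI]].
have JM x : 0 < x -> 0 <= J x <= M.
  by move=> x0; apply: IH (fJ _ x0) => // l ql; rewrite fM// pos_list_cons x0.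
have M0 : 0 <= M by have /andP[] := JM 1 ltr01; exact: le_trans.
rewrite -!lee_fin -JI exp_int_ge0//=; last by move=> x /JM/andP[].
by rewrite -[leRHS](exp_int_cst q0 M0) le_exp_int.
Qed.

Lemma exp_meanD qs f g I I' : all (fun x => 0 < x) qs ->
  exp_mean qs f I -> exp_mean qs g I' -> exp_mean qs (fun l => f l + g l) (I + I').
Proof.
elim: qs f g I I' => [|q qs IH] f g I I' /=; first by move=> _ <- <-.
move=> /andP[q0 qs0] [J [fJ mJ [M JM] JI]] [J' [gJ mJ' [M' JM'] JI']].
exists (fun x => J x + J' x); split.
- by move=> x x0; apply: IH; [exact: qs0|exact: fJ|exact: gJ].
- exact: measurable_funD.
- exists (M + M') => x x0; have /andP[a b] := JM _ x0; have /andP[c d] := JM' _ x0.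
  by rewrite addr_ge0 ?lerD.
rewrite EFinD -JI -JI' /exp_int.
under eq_integral do rewrite mulrDr EFinD.
rewrite ge0_integralD//.
- by move=> x /JM/andP[J0 _]; rewrite lee_fin !mulr_ge0 ?expR_ge0 ?J0//; exact: ltW.
- exact: measurable_exp_int.
- by move=> x /JM'/andP[J0 _]; rewrite lee_fin !mulr_ge0 ?expR_ge0 ?J0//; exact: ltW.
- exact: measurable_exp_int.
Qed.

Lemma exp_meanZ qs f I a : all (fun x => 0 < x) qs -> 0 <= a ->
  exp_mean qs f I -> exp_mean qs (fun l => a * f l) (a * I).
Proof.
elim: qs f I => [|q qs IH] f I /=; first by move=> _ _ <-.
move=> /andP[q0 qs0] a0 [J [fJ mJ [M JM] JI]].
exists (fun x => a * J x); split.
- by move=> x x0; apply: IH => //; exact: fJ.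
- exact: measurable_funM.
- exists (a * M) => x x0; have /andP[b c] := JM _ x0.
  by rewrite mulr_ge0 ?ler_wpM2l.
rewrite EFinM -JI /exp_int -ge0_integralZl//.
- by apply: eq_integral => x _; rewrite -EFinM mulrCA.
- exact: measurable_exp_int.
- by move=> x /JM/andP[J0 _]; rewrite lee_fin !mulr_ge0 ?expR_ge0 ?J0//; exact: ltW.
Qed.

Lemma exp_mean_cst qs a : all (fun x => 0 < x) qs -> 0 <= a -> exp_mean qs (fun=> a) a.
Proof.
move=> + a0; elim: qs => //= q qs IH /andP[q0 qs0].
exists (fun=> a); split => //; [by move=> x _; exact: IH| |exact: exp_int_cst].
by exists a => x _; rewrite a0 lexx.
Qed.

Lemma exp_mean_sum {S : finType} qs (f : S -> seq R -> R) (I : S -> R) :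
  all (fun x => 0 < x) qs -> (forall i, exp_mean qs (f i) (I i)) ->
  exp_mean qs (fun l => \sum_i f i l) (\sum_i I i).
Proof.
move=> qs0 fI; suff : exp_mean qs (\sum_i f i) (\sum_i I i).
  by apply: eq_exp_mean => l _; rewrite fct_sumE.
elim/big_ind2 : _ => [|x x' y y' hx hy|i _]; [exact: exp_mean_cst|exact: exp_meanD|exact: fI].
Qed.

(** That the limit [g] has an iterated mean at all is part of the conclusion: each partial mean of
    [g] is a pointwise limit of measurable ones. Dominated convergence is applied one variable at a
    time. *)
Lemma exp_mean_lim qs (f : nat -> seq R -> R) (I : nat -> R) g M :
  all (fun x => 0 < x) qs ->
  (forall m, exp_mean qs (f m) (I m)) ->
  (forall m l, pos_list qs l -> 0 <= f m l <= M) ->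
  (forall l, pos_list qs l -> f m l @[m --> \oo] --> g l) ->
  exists2 I', exp_mean qs g I' & I m @[m --> \oo] --> I'.
Proof.
elim: qs f I g => [|q qs IH] f I g /=.
  move=> _ fI fM fg; exists (g [::]) => //.
  by rewrite -(_ : f ^~ [::] = I); [exact: fg|apply/funext].
move=> /andP[q0 qs0] /choice[J fJ] fM fg.
have JM m x : 0 < x -> 0 <= J m x <= M.
  have [h _ _ _] := fJ m.
  move=> x0; apply: exp_mean_bound (h _ x0) => // l ql.
  by rewrite fM// pos_list_cons x0.
have M0 : 0 <= M by have /andP[] := JM 0%N 1 ltr01; exact: le_trans.
have lJ x : 0 < x -> exists2 I', exp_mean qs (fun l => g (x :: l)) I' & J m x @[m --> \oo] --> I'.
  move=> x0; apply: (IH (fun m l => f m (x :: l))) => //.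
  - by move=> m; have [h _ _ _] := fJ m; exact: h.
  - by move=> m l ql; rewrite fM// pos_list_cons x0.
  - by move=> l ql; apply: fg; rewrite pos_list_cons x0.
(* Taking [lim] gives a single function of [x] without choosing the witnesses of [lJ]; its value is
   meaningful only for positive [x]. *)
pose K x := lim (J m x @[m --> \oo]).
have JK x : 0 < x -> J m x @[m --> \oo] --> K x.
  by move=> /lJ[I' _ h]; rewrite /K (cvg_lim _ h).
have mK : measurable_fun pos K.
  apply: (@measurable_fun_cvg _ _ _ pos J K); last by move=> x x0; exact: (JK x x0).
  by move=> m; have [] := fJ m.
have KM x : 0 < x -> 0 <= K x <= M.
  move=> x0; apply/andP; split.
    by apply: (cvgr_to_ge (JK _ x0)); apply: nearW => m; have /andP[] := JM m _ x0.
  by apply: (cvgr_to_le (JK _ x0)); apply: nearW => m; have /andP[] := JM m _ x0.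
have Kfin : exp_int q K \is a fin_num.
  rewrite ge0_fin_numE ?exp_int_ge0// => [|x /KM/andP[]//].
  apply: (@le_lt_trans _ _ M%:E); last exact: ltry.
  by rewrite -[leRHS](exp_int_cst q0 M0) le_exp_int.
exists (fine (exp_int q K)).
  exists K; split => //; [|by exists M|by rewrite fineK].
  by move=> x x0; have [I' gI' h] := lJ _ x0; rewrite /K (cvg_lim _ h).
have : exp_int q (J m) @[m --> \oo] --> exp_int q K.
  have mJ m : measurable_fun pos (fun x => (q * expR (- (q * x)) * J m x)%:E).
    by apply: measurable_exp_int; have [] := fJ m.
  have cJ : {ae mu, forall x, pos x ->
      (q * expR (- (q * x)) * J m x)%:E @[m --> \oo] --> (q * expR (- (q * x)) * K x)%:E}.
    apply/aeW => x x0; apply: cvg_EFin; first exact: nearW.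
    by apply: cvgM; [exact: cvg_cst|exact: JK].
  have iM : mu.-integrable pos (fun x => (q * expR (- (q * x)) * M)%:E).
    apply/integrableP; split; first exact: measurable_exp_int.
    suff -> : (\int[mu]_(x in pos) `|(q * expR (- (q * x)) * M)%:E| = M%:E)%E by exact: ltry.
    rewrite -[RHS](exp_int_cst q0 M0); apply: eq_integral => x /set_mem/= x0.
    by rewrite ger0_norm// !mulr_ge0 ?expR_ge0// ltW.
  have bJ : {ae mu, forall x m, pos x ->
      (`|(q * expR (- (q * x)) * J m x)%:E| <= (q * expR (- (q * x)) * M)%:E)%E}.
    apply/aeW => x m x0; have /andP[a b] := JM m _ x0.
    have e0 : 0 <= q * expR (- (q * x)) by rewrite mulr_ge0 ?expR_ge0 ?ltW.
    by rewrite lee_fin ger0_norm; [rewrite ler_wpM2l|rewrite mulr_ge0].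
  by have [] := @dominated_convergence _ _ _ mu _ measurable_pos _ _ _ mJ (@measurable_exp_int q K pos mK) cJ iM bJ.
rewrite -{1}(fineK Kfin) => /fine_cvg; apply: cvg_trans.
by apply: near_eq_cvg; apply: nearW => m /=; have [_ _ _ ->] := fJ m.
Qed.

Fixpoint wsum qs l : R :=
  match qs, l with
  | q :: qs', x :: l' => q * x + wsum qs' l'
  | _, _ => 0
  end.

(** Each variable contributes [q^-1], the quotient of the Laplace kernel by the exponential density.
    The factor [a] is there for the induction: it absorbs the kernel of the outer variable, constant
    in the inner integrals. *)
Lemma iint_exp_mean qs f I a : all (fun x => 0 < x) qs -> 0 <= a ->
  exp_mean qs f I ->
  iint (size qs) (fun l => (a * f l * expR (- wsum qs l))%:E) =
  (a * (\prod_(q <- qs) q^-1) * I)%:E.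
Proof.
elim: qs f I a => [|q qs IH] f I a /=.
  by move=> _ _ <-; rewrite big_nil oppr0 expR0 !mulr1.
move=> /andP[q0 qs0] a0 [J [fJ mJ [M JM] JI]].
set p := \prod_(q <- qs) q^-1.
have p0 : 0 <= p.
  by rewrite /p big_seq; apply: prodr_ge0 => r /(allP qs0) r0; rewrite invr_ge0 ltW.
have -> : (\int[mu]_(x in pos) iint (size qs)
      (fun l => (a * f (x :: l) * expR (- (q * x + wsum qs l)))%:E) =
    \int[mu]_(x in pos) ((a * p * q^-1)%:E * (q * expR (- (q * x)) * J x)%:E))%E.
  apply: eq_integral => x /set_mem/= x0.
  have := IH (fun l => f (x :: l)) (J x) (a * expR (- (q * x))) qs0 (mulr_ge0 a0 (expR_ge0 _)) (fJ _ x0).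
  rewrite -EFinM (_ : a * p * q^-1 * (q * expR (- (q * x)) * J x) =
      a * expR (- (q * x)) * p * J x); last first.
    by field; rewrite lt0r_neq0.
  move=> <-; congr iint; apply/funext => l; congr EFin.
  by rewrite opprD expRD; ring.
rewrite ge0_integralZl//.
- by rewrite -/(exp_int q J) JI -EFinM big_cons -/p; congr EFin; ring.
- exact: measurable_exp_int.
- by move=> x /JM/andP[J0 _]; rewrite lee_fin !mulr_ge0 ?expR_ge0 ?J0//; exact: ltW.
- by rewrite lee_fin !mulr_ge0// invr_ge0 ltW.
Qed.

End exponential_mean.

(** * Duhamel's formula and observation probabilities *)

Section shift.
Context {R : realType}.
Local Notation mu := (@lebesgue_measure R).

Let shift (d : R) (x : R) : measurableTypeR R := x - d.

Let measurable_shift d : measurable_fun [set: R] (shift d).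
Proof. by apply: measurable_funB; [exact: measurable_id|exact: measurable_cst]. Qed.

Let lebesgue_measure_shift d (A : set R) : measurable A -> pushforward mu (shift d) A = mu A.
Proof.
move=> mA; apply/esym/lebesgue_measure_unique => //; first exact: measurable_shift.
move=> msh _ [[a b] _ <-] /=.
rewrite /pushforward (_ : _ @^-1` _ = `]a + d, b + d]%classic); last first.
  by apply/seteqP; split => x /=; rewrite /shift !in_itv/= ltrBrDr lerBlDr.
rewrite !lebesgue_measure_itv/= !lte_fin ltrD2r; case: ifP => // _.
by rewrite -!EFinB; congr EFin; ring.
Qed.

(** This is where lack of memory enters: beyond the first observation time [d], the integral over
    the gap becomes an integral of the same form over the remaining gap [x - d]. *)
Lemma ge0_integral_shift (d : R) (f : R -> \bar R) :
  measurable_fun [set: R] f -> (forall x, 0 <= x -> (0 <= f x)%E) ->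
  (\int[mu]_(x in `[d, +oo[) f (x - d)%R = \int[mu]_(x in `[0%R, +oo[) f x)%E.
Proof.
move=> mf f0; rewrite (_ : `[d, +oo[%classic = shift d @^-1` `[0, +oo[); last first.
  by apply/seteqP; split => x /=; rewrite /shift !in_itv/= !andbT subr_ge0.
transitivity (\int[pushforward mu (shift d)]_(x in `[0%R, +oo[) f x)%E.
  rewrite ge0_integral_pushforward//.
  - exact: measurable_shift.
  - exact: measurable_funS mf.
  - by move=> x /set_mem; rewrite /= in_itv/= andbT; exact: f0.
by apply: eq_measure_integral => [|? A mA _]; [exact: measurable_shift|exact: lebesgue_measure_shift].
Qed.

End shift.

Section duhamel.
Context {R : realType} {E S : finType}.
Local Notation mu := (@lebesgue_measure R).
(* One level of the chain [Z]: [T] acts on the block [iota] as [G - q] and moves it to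
   the block [kappa] at rate [q]. *)
Variables (G : @mxf R E) (T : @mxf R S) (iota kappa : E -> S) (q : R).
Hypothesis TE : forall i (F : S -> R), \sum_s T (iota i) s * F s =
  \sum_l G i l * F (iota l) - q * F (iota i) + q * F (kappa i).
Variable z : R -> S -> R.
Hypothesis dz : forall (y : R) s,
  is_derive y (1 : R) (fun y => z y s) (\sum_s' T s s' * z y s').

Let P (x : R) i l := expf (scalef x G) i l.

Lemma is_derive_fsum (I : finType) (f : I -> R -> R) (df : I -> R) (x : R) :
  (forall i, is_derive x 1 (f i) (df i)) ->
  is_derive x 1 (fun x => \sum_i f i x) (\sum_i df i).
Proof.
move=> fI; rewrite -fct_sumE.
elim/big_ind2 : _ => // [|x1 x2 y1 y2 h1 h2]; [exact: is_derive_cst|exact: is_deriveD].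
Qed.

(** The antiderivative behind Duhamel's formula. In its derivative the forward equation for [P]
    cancels the [G] terms of the backward equation for [z], and the killing rate cancels the
    derivative of the exponential; only the jump term [dH] survives. *)
Let H i d (x : R) := - (expR (- (q * x)) * \sum_l P x i l * z (d - x) (iota l)).
Let dH i d (x : R) := q * expR (- (q * x)) * \sum_l P x i l * z (d - x) (kappa l).

Let is_derive_H i d (x : R) : is_derive x (1 : R) (H i d) (dH i d x).
Proof.
have dzx s : is_derive x 1 (fun x => z (d - x) s) (- \sum_s' T s s' * z (d - x) s').
  have h : is_derive x 1 (fun x => d - x) (-1).
    by have := is_deriveB (is_derive_cst d x 1) (is_derive_id x 1); rewrite sub0r.
  have := @is_derive1_comp _ (z ^~ s) (fun x => d - x) x _ _ (dz (d - x) s) h.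
  by move=> /is_derive_eq; apply; rewrite mulrN1.
have dP l : is_derive x 1 (fun x => P x i l) (\sum_k P x i k * G k l).
  exact: is_derive_expf_right.
have dS : is_derive x 1 (fun x => \sum_l P x i l * z (d - x) (iota l))
    (\sum_l (P x i l *: (- \sum_s' T (iota l) s' * z (d - x) s') +
       z (d - x) (iota l) *: \sum_k P x i k * G k l)).
  by apply: is_derive_fsum => l; exact: is_deriveM.
have de : is_derive x 1 (fun x => expR (- (q * x))) (- q * expR (- (q * x))).
  have h : is_derive x 1 (fun x => - (q * x)) (- q).
    have := is_deriveN (is_deriveZ q (is_derive_id x (1 : R))).
    by move=> /is_derive_eq; apply; rewrite /GRing.scale/= mulr1.
  have := @is_derive1_comp _ expR (fun x => - (q * x)) x _ _ (is_derive_expR _) h.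
  by move=> /is_derive_eq; apply; rewrite mulrC.
have := is_deriveN (is_deriveM de dS).
move=> /is_derive_eq; apply; rewrite /GRing.scale/=.
set u := fun l => z (d - x) (iota l); set w := fun l => z (d - x) (kappa l).
have -> : \sum_l (P x i l * - (\sum_s' T (iota l) s' * z (d - x) s') +
    u l * (\sum_k P x i k * G k l)) =
    q * (\sum_l P x i l * u l) - q * \sum_l P x i l * w l.
  under eq_bigr do rewrite TE.
  rewrite big_split/=.
  have -> : \sum_l u l * (\sum_k P x i k * G k l) =
      \sum_l P x i l * \sum_k G l k * u k.
    under eq_bigr do rewrite mulr_sumr.
    rewrite exchange_big/=; apply: eq_bigr => l _; rewrite mulr_sumr.
    by apply: eq_bigr => k _; ring.
  rewrite -big_split/= !mulr_sumr -sumrB; apply: eq_bigr => l _.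
  by rewrite -/(u l) -/(w l); ring.
by rewrite /dH -/u; ring.
Qed.

Lemma duhamel (i : E) (d : R) : 0 < d ->
  (\int[mu]_(x in `]0%R, d[) (q * expR (- (q * x)) *
     \sum_l expf (scalef x G) i l * z (d - x) (kappa l))%:E =
   (z d (iota i) - expR (- (q * d)) * \sum_l expf (scalef d G) i l * z 0 (iota l))%:E)%E.
Proof.
move=> d0.
have cdH : continuous (dH i d).
  move=> x; apply: cvgM.
    apply: cvgM; first exact: cvg_cst.
    apply: continuous_comp; last exact: continuous_expR.
    by apply: cvgN; apply: cvgM; [exact: cvg_cst|exact: cvg_id].
  apply: cvg_fsum => l; apply: cvgM; first exact: continuous_expf.
  apply: (@continuous_comp _ _ _ (fun x => d - x) (fun y => z y (kappa l))).
    by apply: cvgB; [exact: cvg_cst|exact: cvg_id].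
  apply/differentiable_continuous/derivable1_diffP.
  by have [] := dz (d - x) (kappa l).
have cH : continuous (H i d).
  move=> x; apply/differentiable_continuous/derivable1_diffP.
  by have [] := is_derive_H i d x.
rewrite -(@integral_itv_bndoo _ _ _ _ true false); last first.
  apply/measurable_EFinP; apply: measurable_funTS.
  exact: continuous_measurable_fun.
rewrite (@continuous_FTC2 _ (dH i d) (H i d))//.
- rewrite -EFinB; congr EFin; rewrite /H (subrr d) (subr0 d) mulr0 oppr0 expR0 mul1r.
  rewrite /P opprK addrC; congr (_ - _).
  under eq_bigr do rewrite expf0.
  exact: sum_idf.
- exact: continuous_subspaceT.
- split.
  + by move=> x _; have [] := is_derive_H i d x.
  + exact/cvg_at_right_filter/cH.
  + exact/cvg_at_left_filter/cH.
- by move=> x _; rewrite derive1E; have [] := is_derive_H i d x.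
Qed.

End duhamel.

(** * Observation probabilities over one level *)

Section observations.
Context {R : realType} {E : finType}.
Local Notation mu := (@lebesgue_measure R).
Implicit Types (G : @mxf R E) (o : seq (R * E)) (A : seq (R * E) -> E -> R).

(* [[:: (d_1, j_1); (d_2, j_2); ...]] stands for the observation of the states [j_1],
   [j_2], ... at the times [d_1], [d_1 + d_2], ...; in [cstep] the chain has generator [G]
   up to time [x], and [A] gives the probabilities of the observations made from then on. *)
Definition pos_obs o := all (fun p => 0 < p.1) o.

Fixpoint hobs G o i : R :=
  if o is (d, j) :: o' then expf (scalef d G) i j * hobs G o' j else 1.

(** Only the [E]-component is observed, so the level [k] is summed out at each observation, but it
    remains part of the state from which the next transition starts. *)
Fixpoint zobs {L : finType} (T : @mxf R (L * E)%type) o (a : L * E) : R :=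
  if o is (d, j) :: o' then
    \sum_k expf (scalef d T) a (k, j) * zobs T o' (k, j)
  else 1.

Fixpoint cstep G A o (x : R) i : R :=
  if o is (d, j) :: o' then
    if d <= x then expf (scalef d G) i j * cstep G A o' (x - d) j
    else \sum_l expf (scalef x G) i l * A ((d - x, j) :: o') l
  else 1.

Lemma scalef_generator {S : finType} (a : R) (A : @mxf R S) :
  0 <= a -> is_generator A -> is_generator (scalef a A).
Proof.
move=> a0 [A0 A1]; split=> [i j ij|i]; first by rewrite /scalef mulr_ge0// A0.
by rewrite /scalef -mulr_sumr A1 mulr0.
Qed.

Lemma expf_le1 {S : finType} (A : @mxf R S) i j :
  is_generator A -> 0 <= expf A i j <= 1.
Proof.
move=> /expf_stoch[A0 A1]; rewrite A0/= -(A1 i) (bigD1 j)//= lerDl.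
by apply: sumr_ge0.
Qed.

Lemma expf_avg {S : finType} (A : @mxf R S) (F : S -> R) i : is_generator A ->
  (forall j, 0 <= F j <= 1) -> 0 <= \sum_j expf A i j * F j <= 1.
Proof.
move=> /expf_stoch[A0 A1] F01; rewrite sumr_ge0/=; last first.
  by move=> j _; rewrite mulr_ge0//; have /andP[] := F01 j.
rewrite -(A1 i); apply: ler_sum => j _; rewrite ler_piMr//.
by have /andP[] := F01 j.
Qed.

Lemma mulr01 (x y : R) : 0 <= x <= 1 -> 0 <= y <= 1 -> 0 <= x * y <= 1.
Proof. by move=> /andP[x0 x1] /andP[y0 y1]; rewrite mulr_ge0 ?mulr_ile1. Qed.

Lemma bool01 (b : bool) : 0 <= (b%:R : R) <= 1.
Proof. by case: b; rewrite ?ler01 ?lexx. Qed.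

Lemma zobs_bound (L : finType) (T : @mxf R (L * E)%type) o a :
  is_generator T -> pos_obs o -> 0 <= zobs T o a <= 1.
Proof.
move=> gT; elim: o a => [|[d j] o IH] a /=; first by rewrite ler01 lexx.
move=> /andP[d0 o0]; have gdT := scalef_generator (ltW d0) gT.
(* The sum over the states [(k, j)] is turned into a full average over the row by an indicator, so
   that stochasticity applies. *)
have /andP[_ le1] := @expf_avg _ _ (fun b => zobs T o b * (b.2 == j)%:R) a gdT
  (fun b => mulr01 (IH b o0) (bool01 _)).
have /expf_stoch[T0 _] := gdT.
rewrite sumr_ge0/=; last by move=> k _; rewrite mulr_ge0//; have /andP[] := IH (k, j) o0.
apply: le_trans le1.
rewrite [leRHS](_ : _ = \sum_k \sum_l expf (scalef d T) a (k, l) *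
    (zobs T o (k, l) * (l == j)%:R)); last first.
  by rewrite pair_bigA; apply: eq_bigr => -[].
apply: ler_sum => k _; rewrite (bigD1 j)//= eqxx mulr1 lerDl sumr_ge0// => l lj.
by rewrite (negbTE lj) !mulr0.
Qed.

Lemma cstep_bound G A o x i : is_generator G ->
  (forall o l, pos_obs o -> 0 <= A o l <= 1) ->
  pos_obs o -> 0 <= x -> 0 <= cstep G A o x i <= 1.
Proof.
move=> gG A01; elim: o x i => [|[d j] o IH] x i /=; first by rewrite ler01 lexx.
move=> /andP[d0 o0] x0; case: (leP d x) => dx.
  apply: mulr01; last by apply: IH; rewrite ?subr_ge0.
  by apply: expf_le1; apply: scalef_generator (ltW d0) gG.
apply: expf_avg; first exact: scalef_generator.
by move=> l; rewrite A01//= subr_gt0 dx.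
Qed.

Lemma measurable_cstep G A o i :
  (forall j o l, continuous (fun y => A ((y, j) :: o) l)) ->
  measurable_fun [set: R] (fun x => cstep G A o x i).
Proof.
move=> cA; elim: o i => [|[d j] o IH] i /=; first exact: measurable_cst.
apply: measurable_fun_if => //.
- by apply: measurable_fun_ler; [exact: measurable_cst|exact: measurable_id].
- apply: measurable_funTS; apply: measurable_funM; first exact: measurable_cst.
  apply: (measurableT_comp (IH j)).
  by apply: measurable_funB; [exact: measurable_id|exact: measurable_cst].
- apply: measurable_funTS; apply: continuous_measurable_fun => x.
  apply: cvg_fsum => l; apply: cvgM; first exact: continuous_expf.
  apply: (@continuous_comp _ _ _ (fun x => d - x) (fun y => A ((y, j) :: o) l)).
    by apply: cvgB; [exact: cvg_cst|exact: cvg_id].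
  exact: cA.
Qed.

(** Evaluates the boundary term that Duhamel's formula leaves at remaining time zero. *)
Lemma zobs0 (L : finType) (T : @mxf R (L * E)%type) j o m l :
  zobs T ((0, j) :: o) (m, l) = idf l j * zobs T o (m, j).
Proof.
rewrite /=.
under eq_bigr => k _.
  rewrite expf0 (_ : idf (m, l) (k, j) = idf m k * idf l j); last first.
    by rewrite /idf xpair_eqE -natrM mulnb.
  rewrite -mulrA; over.
by rewrite sum_idf.
Qed.

Lemma is_derive_zobs (L : finType) (T : @mxf R (L * E)%type) j o (y : R) a :
  is_derive y (1 : R) (fun y => zobs T ((y, j) :: o) a)
    (\sum_b T a b * zobs T ((y, j) :: o) b).
Proof.
rewrite /=.
have -> : \sum_b T a b * (\sum_k expf (scalef y T) b (k, j) * zobs T o (k, j)) =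
   \sum_k (zobs T o (k, j) *: (\sum_b T a b * expf (scalef y T) b (k, j))).
  under eq_bigr do rewrite mulr_sumr.
  rewrite exchange_big/=; apply: eq_bigr => k _; rewrite /GRing.scale/= mulr_sumr.
  by apply: eq_bigr => b _; rewrite mulrA mulrC.
apply: is_derive_fsum => k.
rewrite (_ : (fun x => _) = zobs T o (k, j) *: (fun x => expf (scalef x T) a (k, j))).
  exact/is_deriveZ/is_derive_expf_left.
by apply/funext => x; rewrite mulrC.
Qed.

Lemma continuous_zobs (L : finType) (T : @mxf R (L * E)%type) j o a :
  continuous (fun y => zobs T ((y, j) :: o) a).
Proof.
move=> y; apply/differentiable_continuous/derivable1_diffP.
by have [] := is_derive_zobs T j o y a.
Qed.

(** Duhamel's formula with rate 0 and [kappa = iota]: on a level without exit the integral vanishes,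
    and what is left says that the exponential of [T] acts there as that of [G]. *)
Lemma zobs_last (L : finType) (T : @mxf R (L * E)%type) G m o i :
  (forall i (F : L * E -> R), \sum_b T (m, i) b * F b = \sum_l G i l * F (m, l)) ->
  pos_obs o -> zobs T o (m, i) = hobs G o i.
Proof.
move=> TE; elim: o i => [//|[d j] o IH] i /andP[d0 o0].
have := @duhamel _ _ _ G T (fun l => (m, l)) (fun l => (m, l)) 0
  ltac:(by move=> k F; rewrite TE !mul0r subr0 addr0)
  (fun y => zobs T ((y, j) :: o)) (fun y a => is_derive_zobs T j o y a) i d d0.
rewrite integral0_eq; last by move=> x _; rewrite !mul0r.
move=> /eqP; rewrite eqe eq_sym subr_eq0 => /eqP ->.
rewrite mul0r oppr0 expR0 mul1r.
under eq_bigr do rewrite zobs0 IH// mulrCA.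
rewrite (bigD1 j)//= /idf eqxx mul1r big1 ?addr0// => l lj.
by rewrite (negbTE lj) mul0r.
Qed.

Lemma zobs_cons (L : finType) (T : @mxf R (L * E)%type) d j o a :
  zobs T ((d, j) :: o) a = \sum_k expf (scalef d T) a (k, j) * zobs T o (k, j).
Proof. by []. Qed.

Lemma cstep_cons G A d j o x i : cstep G A ((d, j) :: o) x i =
  if d <= x then expf (scalef d G) i j * cstep G A o (x - d) j
  else \sum_l expf (scalef x G) i l * A ((d - x, j) :: o) l.
Proof. by []. Qed.

#[local] Arguments zobs : simpl never.
#[local] Arguments cstep : simpl never.

Lemma exp_int_cstep (L : finType) (T : @mxf R (L * E)%type) G m m' q o i :
  0 < q -> is_generator T -> is_generator G ->
  (forall i (F : L * E -> R), \sum_b T (m, i) b * F b =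
    \sum_l G i l * F (m, l) - q * F (m, i) + q * F (m', i)) ->
  pos_obs o ->
  exp_int q (fun x => cstep G (fun o l => zobs T o (m', l)) o x i) =
  (zobs T o (m, i))%:E.
Proof.
move=> q0 gT gG TE; elim: o i => [|[d j] o IH] i; first by move=> _; rewrite exp_int_cst.
move=> /andP[/= d0 o0].
set A := fun o l => zobs T o (m', l).
have A01 o' l : pos_obs o' -> 0 <= A o' l <= 1 by move=> h; exact: zobs_bound.
have cA j' o' l : continuous (fun y => A ((y, j') :: o') l) by exact: continuous_zobs.
have mC o' k : measurable_fun [set: R] (fun x => cstep G A o' x k) by exact: measurable_cstep.
have C0 o' k x : pos_obs o' -> 0 <= x -> 0 <= cstep G A o' x k.
  by move=> h x0; have /andP[] := cstep_bound k gG A01 h x0.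
have posE : [set x : R | 0 < x] = `]0, d[%classic `|` `[d, +oo[%classic.
  apply/seteqP; split => x /=; rewrite !in_itv/= andbT; last first.
    by move=> [/andP[]//|]; exact: lt_le_trans.
  by move=> x0; case: (leP d x) => dx; [by right|left; exact/andP].
rewrite /exp_int posE ge0_integral_setU//; last 3 first.
- apply: measurable_exp_int; apply: measurable_funTS; exact: mC.
- move=> x; rewrite -posE => /= x0.
  by rewrite lee_fin !mulr_ge0 ?expR_ge0 ?(ltW q0)//; apply: C0 (ltW x0); rewrite /= d0.
- apply/disj_set2P/seteqP; split => x //=; rewrite !in_itv/= andbT => -[/andP[_]].
  by rewrite ltNge => /negP.
have -> : (\int[mu]_(x in `]0%R, d[) (q * expR (- (q * x)) * cstep G A ((d, j) :: o) x i)%:E =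
   \int[mu]_(x in `]0%R, d[) (q * expR (- (q * x)) *
     \sum_l expf (scalef x G) i l * zobs T ((d - x, j) :: o) (m', l))%:E)%E.
  apply: eq_integral => x /set_mem; rewrite /= in_itv/= => /andP[_ xd].
  by rewrite cstep_cons leNgt xd.
have := @duhamel _ _ _ G T (fun l => (m, l)) (fun l => (m', l)) q TE
  (fun y => zobs T ((y, j) :: o)) (fun y a => is_derive_zobs T j o y a) i d d0.
move=> ->.
have -> : (\int[mu]_(x in `[d, +oo[) (q * expR (- (q * x)) * cstep G A ((d, j) :: o) x i)%:E =
   \int[mu]_(x in `[d, +oo[) ((expR (- (q * d)) * expf (scalef d G) i j)%:E *
     (q * expR (- (q * (x - d)%R)) * cstep G A o (x - d)%R j)%:E))%E.
  apply: eq_integral => x /set_mem; rewrite /= in_itv/= andbT => dx.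
  rewrite cstep_cons dx -EFinM; congr EFin.
  have -> : - (q * x) = - (q * d) + - (q * (x - d)) by ring.
  by rewrite expRD; ring.
have e0 : 0 <= expR (- (q * d)) * expf (scalef d G) i j.
  by rewrite mulr_ge0 ?expR_ge0//; have /andP[] := expf_le1 i j (scalef_generator (ltW d0) gG).
have mf : measurable_fun [set: R] (fun x => (q * expR (- (q * x)) * cstep G A o x j)%:E).
  exact: measurable_exp_int.
have f0 x : 0 <= x -> (0 <= (q * expR (- (q * x)) * cstep G A o x j)%:E)%E.
  by move=> x0; rewrite lee_fin !mulr_ge0 ?expR_ge0 ?(ltW q0)//; exact: C0.
rewrite ge0_integralZl//; last 2 first.
- apply: measurable_funTS.
  apply: (measurableT_comp mf).
  by apply: measurable_funB; [exact: measurable_id|exact: measurable_cst].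
- by move=> x; rewrite /= in_itv/= andbT => dx; apply: f0; rewrite subr_ge0.
rewrite (ge0_integral_shift d mf f0) -integral_itv_obnd_cbnd; last exact: measurable_funTS.
rewrite -pos_itv -/(exp_int q (fun x => cstep G A o x j)) IH// -EFinM -EFinD; congr EFin.
(* The boundary term of Duhamel's formula collapses to [l = j] and cancels what the induction
   hypothesis gives for the gaps beyond [d]. *)
under [X in _ - _ * X]eq_bigr do rewrite zobs0 mulrCA.
rewrite [X in _ - _ * X](bigD1 j)//= {1}/idf eqxx mul1r big1; last first.
  by move=> l lj; rewrite /idf (negbTE lj) mul0r.
by rewrite addr0; ring.
Qed.

End observations.

#[global] Arguments zobs : simpl never.
#[global] Arguments cstep : simpl never.

(** * Induction over the levels of the block chain *)

Section levels.
Context {R : realType} {E : finType} {n : nat}.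
Variables (G : 'I_n.+1 -> @mxf R E) (q : 'I_n -> R).
Hypothesis gG : forall k, is_generator (G k).
Implicit Types (o : seq (R * E)) (ul : seq R) (i j : E) (m : nat).

(** Observation probabilities of the inhomogeneous chain on its stretch [m], with [ul] the gaps
    still to come. When [ul] is exhausted the current generator is kept forever. *)
Fixpoint bobs m ul o i : R :=
  if ul is x :: ul' then cstep (G (inord m)) (fun o l => bobs m.+1 ul' o l) o x i
  else hobs (G (inord m)) o i.

(** With the first gap fixed at [x], [cstep] involves the later gaps only through one non-negative
    linear combination of values of [A], or not at all; hence it commutes with the mean over
    them. *)
Lemma exp_mean_cstep qs (H : @mxf R E) (A : seq R -> seq (R * E) -> E -> R) A' o x i :
  all (fun x => 0 < x) qs -> is_generator H ->
  (forall o l, pos_obs o -> exp_mean qs (fun ul => A ul o l) (A' o l)) ->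
  pos_obs o -> 0 <= x ->
  exp_mean qs (fun ul => cstep H (A ul) o x i) (cstep H A' o x i).
Proof.
move=> qs0 gH AA'; elim: o x i => [|[d j] o IH] x i /=.
  by move=> _ _; exact: exp_mean_cst.
move=> /andP[d0 o0] x0; rewrite cstep_cons.
under eq_fun do rewrite cstep_cons.
case: (leP d x) => dx.
  apply: exp_meanZ => //; last by apply: IH; rewrite ?subr_ge0.
  by have /andP[] := expf_le1 i j (scalef_generator (ltW d0) gH).
apply: exp_mean_sum => // l; apply: exp_meanZ => //.
  by have /andP[] := expf_le1 i l (scalef_generator x0 gH).
by apply: AA'; rewrite /= subr_gt0 dx.
Qed.

Hypothesis q0 : forall k, 0 < q k.
Local Notation T := (tgen G q).

Lemma qat_ord (k : 'I_n) : qat q k = q k.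
Proof. by rewrite /qat valK. Qed.

Lemma qat_n m : (n <= m)%N -> qat q m = 0.
Proof. by move=> nm; rewrite /qat insubF// ltnNge nm. Qed.

Lemma qat_ge0 m : 0 <= qat q m.
Proof.
rewrite /qat; case: insubP => [k _ _|_] //=; exact: ltW.
Qed.

(** The form required by the hypothesis [TE] of [duhamel], uniform in the level. At the last level
    [inord m.+1] is out of range and denotes a default, but it is multiplied by the rate
    [qat q m = 0]. *)
Lemma tgenE (m : 'I_n.+1) i (F : 'I_n.+1 * E -> R) :
  \sum_b T (m, i) b * F b = \sum_l G m i l * F (m, l) - qat q m * F (m, i) +
    qat q m * F (inord m.+1, i).
Proof.
rewrite (eq_bigr (fun b => (if m == b.1 then G m i b.2 * F b else 0) -
    (qat q m * ((m == b.1) && (i == b.2))%:R * F b) +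
    (qat q m * (((b.1 : nat) == m.+1) && (i == b.2))%:R * F b))); last first.
  move=> [k l] _; rewrite /tgen/=.
  have [<-|mk] := eqVneq m k.
    by rewrite (ltn_eqF (ltnSn m)) /= mulr0 mul0r addr0 mulrBl.
  by rewrite mulr0 mul0r subrr add0r; case: eqP => //= _; rewrite mulr0 !mul0r.
rewrite !big_split/= sumrN; congr (_ - _ + _).
- transitivity (\sum_k \sum_l (if m == k then G m i l * F (k, l) else 0)).
    by rewrite pair_bigA; apply: eq_bigr => -[].
  rewrite (bigD1 m)//= eqxx [X in _ + X]big1 ?addr0// => k mk.
  by rewrite eq_sym (negbTE mk) big1.
- rewrite (bigD1 (m, i))//= !eqxx mulr1 big1 ?addr0// => -[k l]/=.
  by rewrite xpair_eqE ![m == _]eq_sym ![i == _]eq_sym => /negbTE ->; rewrite mulr0 mul0r.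
- have [nm|mn] := leqP n m.
    by rewrite qat_n// mul0r big1// => b _; rewrite !mul0r.
  have im : (inord m.+1 : 'I_n.+1) = m.+1 :> nat by rewrite inordK.
  rewrite (bigD1 (inord m.+1, i))//= im !eqxx mulr1 big1 ?addr0// => -[k l]/=.
  rewrite xpair_eqE -val_eqE/= im ![i == _]eq_sym => /negbTE ->; rewrite mulr0 mul0r//.
Qed.

Lemma tgen_generator : is_generator T.
Proof.
split=> [[m i] [k l]|[m i]].
  rewrite xpair_eqE negb_and /tgen/=; case: eqVneq => [_ /= il|mk _].
    rewrite (negbTE il) mulr0 subr0; have [+ _] := gG m; exact.
  by case: ifP => // _; rewrite mulr_ge0 ?qat_ge0.
have := tgenE m i (fun=> 1).
under eq_bigr do rewrite mulr1.
move=> ->; have [_ g] := gG m.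
under eq_bigr do rewrite mulr1.
by rewrite g; ring.
Qed.

(** The gaps after the first are averaged with the first one fixed, by [exp_mean_cstep] and
    induction; the first gap is then averaged by [exp_int_cstep]. *)
Lemma exp_mean_bobs qs m o i : (m + size qs = n)%N ->
  (forall k, (k < size qs)%N -> nth 0 qs k = qat q (m + k)) ->
  pos_obs o ->
  exp_mean qs (fun ul => bobs m ul o i) (zobs T o (inord m, i)).
Proof.
elim: qs m o i => [|r qs IH] m o i /= mn qsE o0.
  apply/esym/zobs_last => // k F; rewrite tgenE.
  have -> : qat q (inord m : 'I_n.+1) = 0 by rewrite qat_n// inordK -mn addn0.
  by rewrite !mul0r subr0 addr0.
have mn' : (m < n)%N by rewrite -mn -addSnnS ltnS leq_addr.
have rE : r = qat q m by have := qsE 0%N isT; rewrite addn0.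
have r0 : 0 < r by rewrite rE /qat insubT/=.
have qs0 : all (fun x => 0 < x) qs.
  apply/(all_nthP 0) => k kqs; have := qsE k.+1 kqs => /= ->.
  by rewrite /qat insubT//= -mn addnS -addSn addnS ltnS ltn_add2l.
have IH' o' l : pos_obs o' ->
    exp_mean qs (fun ul => bobs m.+1 ul o' l) (zobs T o' (inord m.+1, l)).
  apply: IH; first by rewrite addSnnS.
  by move=> k kqs; rewrite addSnnS -(qsE k.+1).
pose A := fun o l => zobs T o (inord m.+1 : 'I_n.+1, l).
have A01 o' l : pos_obs o' -> 0 <= A o' l <= 1.
  by move=> h; exact: zobs_bound tgen_generator h.
exists (fun x => cstep (G (inord m)) A o x i); split.
- by move=> x x0; apply: exp_mean_cstep (ltW x0).
- apply: measurable_funTS; apply: measurable_cstep => j o' l; exact: continuous_zobs.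
- by exists 1 => x x0; exact: cstep_bound (ltW x0).
- apply: exp_int_cstep => //; first exact: tgen_generator.
  by move=> k F; rewrite tgenE inordK ?ltnS ?(ltnW mn')// -rE.
Qed.

End levels.

(** * Finite-dimensional distributions *)

Lemma measure_partition {d} {T : measurableType d} {R : realType}
    (P : {measure set T -> \bar R}) {I : finType} (A : set T) (B : I -> set T) :
  measurable A -> (forall k, measurable (B k)) ->
  (forall w, A w -> exists k, B k w) ->
  (forall k k' w, B k w -> B k' w -> k = k') ->
  P A = (\sum_k P (A `&` B k))%E.
Proof.
move=> mA mB AB disj.
rewrite fsbig_seq ?index_enum_uniq// -measure_fin_bigcup//.
- congr (P _); apply/seteqP; split => w; last by move=> [k _ []].
  by move=> Aw; have [k Bk] := AB _ Aw; exists k; rewrite //= mem_index_enum.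
- by apply/trivIsetP => k k' _ _ /eqP kk'; apply/seteqP; split => // w [[_ h] [_ /(disj _ _ _ h)]].
- by move=> k _; exact: measurableI.
Qed.

Fixpoint oev {R : realType} {E : finType} (x : R -> E) (t : R) (o : seq (R * E)) : Prop :=
  if o is (d, j) :: o' then x (t + d) = j /\ oev x (t + d) o' else True.

(** * The Markov property given a past event *)

Section conditioning.
Context {R : realType} {d} {TT : measurableType d} {S : finType} {nb : nat}.
Variables (P : probability TT R) (X : R -> TT -> S) (s : 'I_nb -> R) (G : 'I_nb.+1 -> @mxf R S).
Hypothesis mX : forall t i, 0 <= t -> measurable [set w | X t w = i].

Lemma measurable_comp_fin {E : finType} (f : S -> E) t j : 0 <= t ->
  measurable [set w | f (X t w) = j].
Proof.
move=> t0.
rewrite (_ : [set w | _] = \bigcup_(i in [set i | f i = j]) [set w | X t w = i]).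
  by apply: fin_bigcup_measurable => [|i _]; [exact: finite_finset|exact: mX].
by apply/seteqP; split => w /=; [move=> <-; exists (X t w)|move=> [i <- <-]].
Qed.

Lemma measurable_oev {E : finType} (f : S -> E) t o : 0 <= t -> pos_obs o ->
  measurable [set w | oev (fun r => f (X r w)) t o].
Proof.
elim: o t => [|[e j] o IH] t t0 /=; first by rewrite (_ : [set _ | _] = setT)//; apply/seteqP.
move=> /andP[e0 o0]; have te0 : 0 <= t + e by rewrite addr_ge0// ltW.
by apply: (@measurableI _ _ [set w | f (X (t + e) w) = j]); [exact: measurable_comp_fin|exact: IH].
Qed.

(* The event [H], anterior to time [t], satisfies the Markov property at time [t]
   in state [i], where [p] is the probability of [H] and [X t = i]. *)
Definition markov_past (H : set TT) (p t : R) (i : S) : Prop :=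
  forall (K : nat) (tt : nat -> R) (ii : nat -> S), tt 0%N = t -> ii 0%N = i ->
    (forall k, (k < K)%N -> tt k < tt k.+1 /\ no_brk s (tt k) (tt k.+1)) ->
    P (H `&` [set w | forall k, (k <= K)%N -> X (tt k) w = ii k]) =
    (p * \prod_(k < K) expf (scalef (tt k.+1 - tt k) (genAt s G (tt k)))
                            (ii k) (ii k.+1))%:E.

Lemma markov_past_measure H p t i : markov_past H p t i ->
  P (H `&` [set w | X t w = i]) = p%:E.
Proof.
move=> /(_ 0%N (fun=> t) (fun=> i) erefl erefl); rewrite big_ord0 mulr1.
move=> <-//; congr (P (_ `&` _)).
by apply/seteqP; split => w /= => [h [|k]|/(_ 0%N)] //; apply.
Qed.

(** The assumed property is read on the time grid with [t] prepended. The step may not straddle a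
    break, so a break lying between two observations has to be inserted as a further time. *)
Lemma markov_past_step H p t t' i j : markov_past H p t i ->
  t < t' -> no_brk s t t' ->
  markov_past (H `&` [set w | X t w = i])
    (p * expf (scalef (t' - t) (genAt s G t)) i j) t' j.
Proof.
move=> HP tt' brk K tt ii tt0 ii0 ttK.
pose tt1 k := if k is k'.+1 then tt k' else t.
pose ii1 k := if k is k'.+1 then ii k' else i.
have := HP K.+1 tt1 ii1 erefl erefl.
rewrite big_ord_recl/= /bump/= tt0 ii0 mulrA => <-.
  congr (P _); rewrite -setIA; congr (_ `&` _).
  apply/seteqP; split => w /=; last first.
    by move=> h; split => [|k kK]; [exact: (h 0%N)|exact: (h k.+1)].
  by move=> [h0 h] [|k]//= kK; exact: h.
by move=> [|k] kK /=; [rewrite tt0|exact: ttK].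
Qed.

End conditioning.

Lemma markov_past0 {R : realType} {d} {TT : measurableType d} {S : finType} {nb : nat}
  (P : probability TT R) (X : R -> TT -> S) (s : 'I_nb -> R) (G : 'I_nb.+1 -> @mxf R S) i :
  markov_chain P X s G ->
  markov_past P X s G setT (fine (P [set w | X 0 w = i])) 0 i.
Proof.
move=> [mX _ fdd] K tt ii tt0 ii0 ttK; rewrite setTI fdd// ii0 EFinM fineK//.
by rewrite fin_num_measure//; exact: mX.
Qed.

Section inhomogeneous.
Context {R : realType} {d} {TT : measurableType d} {E : finType} {n : nat}.
Variables (P : probability TT R) (X : R -> TT -> E) (s : 'I_n -> R) (G : 'I_n.+1 -> @mxf R E).
Hypothesis mX : forall t i, 0 <= t -> measurable [set w | X t w = i].
Implicit Types (o : seq (R * E)) (ul : seq R) (i j : E) (m : nat).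

(* [ul] lists the gaps from time [t] to the breaks [s_m < s_(m+1) < ...]. *)
Fixpoint gaps m (t : R) ul : Prop :=
  if ul is x :: ul' then
    (forall k : 'I_n, k = m :> nat -> s k = t + x) /\ gaps m.+1 (t + x) ul'
  else True.

Lemma gaps_ge m t ul (k : 'I_n) : (m + size ul = n)%N -> gaps m t ul ->
  all (fun x => 0 <= x) ul -> (m <= k)%N -> t <= s k.
Proof.
elim: ul m t => [|x ul IH] m t /=.
  by rewrite addn0 => -> _ _; rewrite leqNgt ltn_ord.
move=> mn [sm g] /andP[x0 ul0]; rewrite leq_eqVlt => /predU1P[km|mk].
  by rewrite sm// lerDl.
by apply: le_trans (IH m.+1 (t + x) _ g ul0 mk); rewrite ?lerDl// addSnnS.
Qed.

Lemma genAt_gaps m t : (m <= n)%N ->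
  (forall k : 'I_n, (k < m)%N -> s k <= t) ->
  (forall k : 'I_n, (m <= k)%N -> t < s k) -> genAt s G t = G (inord m).
Proof.
move=> mn lt ge; rewrite /genAt; congr (G (inord _)).
rewrite (eq_card (B := [pred k : 'I_n | (k < m)%N])); last first.
  move=> k; rewrite !inE; case: (ltnP k m) => km; first by rewrite lt.
  by apply/negbTE; rewrite -ltNge ge.
rewrite -sum1_card (eq_bigl (fun k : 'I_n => (k < m)%N))//.
by rewrite -(big_ord_widen n (fun=> 1%N) mn) sum_nat_const card_ord muln1.
Qed.

Lemma no_brk_gaps m t t' :
  (forall k : 'I_n, (k < m)%N -> s k <= t) ->
  (forall k : 'I_n, (m <= k)%N -> t' <= s k) -> no_brk s t t'.
Proof.
move=> lt ge k /andP[]; case: (ltnP k m) => km; first by rewrite ltNge lt.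
by move=> _; rewrite ltNge ge.
Qed.

(** The first gap may be 0 while the later ones are positive: an observation can fall exactly on a
    break, and the chain is then at the end of its stretch. *)
Lemma fdd_inhomogeneous H p t i m ul o :
  (forall k, is_generator (G k)) ->
  (m + size ul = n)%N -> (forall k : 'I_n, (k < m)%N -> s k <= t) ->
  gaps m t ul -> all (fun x => 0 <= x) ul -> all (fun x => 0 < x) (behead ul) ->
  measurable H -> 0 <= t -> markov_past P X s G H p t i -> pos_obs o ->
  P (H `&` [set w | X t w = i] `&` [set w | oev (X ^~ w) t o]) =
  (p * bobs G m ul o i)%:E.
Proof.
move=> gG.
have oev_nil K y : K `&` [set w | oev (X ^~ w) y [::]] = K.
  by apply/seteqP; split => // w [].
have oev_cons K y e j o' : K `&` [set w | oev (X ^~ w) y ((e, j) :: o')] =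
    K `&` [set w | X (y + e) w = j] `&` [set w | oev (X ^~ w) (y + e) o'].
  by rewrite -setIA.
elim: ul H p t i m o => [|x ul IHul] H p t i m o.
  rewrite addn0 => -> st _ _ _.
  elim: o H p t i st => [|[e j] o IH] H p t i st mH t0 HP.
    by rewrite oev_nil (markov_past_measure HP) mulr1.
  move=> /= /andP[e0 o0].
  have ge (k : 'I_n) : (n <= k)%N -> false by rewrite leqNgt ltn_ord.
  have te : t < t + e by rewrite ltrDl.
  have brk : no_brk s t (t + e) by apply: (no_brk_gaps st) => k /ge.
  have := markov_past_step (j := j) HP te brk.
  rewrite (genAt_gaps (leqnn n) st) => [HP'|k /ge//].
  rewrite oev_cons (IH _ _ _ _ _ _ _ HP' o0).
  - by rewrite addrAC subrr add0r mulrA.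
  - by move=> k kn; rewrite (le_trans (st _ kn))// ltW.
  - by apply: measurableI => //; exact: mX.
  - by rewrite addr_ge0// ltW.
rewrite /= -addSnnS => mn' st g /andP[x0 ul0] ulp.
elim: o H p t i x x0 st g => [|[e j] o IH] H p t i x x0 st [sm g] mH t0 HP.
  by rewrite oev_nil (markov_past_measure HP) mulr1.
move=> /= /andP[e0 o0]; rewrite cstep_cons.
have ge (k : 'I_n) : (m <= k)%N -> t + x <= s k.
  rewrite leq_eqVlt => /predU1P[mk|mk]; first by rewrite sm.
  exact: gaps_ge mn' g ul0 mk.
have st' (k : 'I_n) : (k < m.+1)%N -> s k <= t + x.
  rewrite ltnS leq_eqVlt => /predU1P[km|km]; first by rewrite sm.
  by rewrite (le_trans (st _ km))// lerDl.
have ul0' : all (fun x => 0 < x) (behead ul) by case: ul ulp {IHul IH g ul0 mn'} => //= ? ? /andP[].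
(* With no time left on the stretch, the transition matrix in [cstep] is the identity, and the next
   stretch takes over at the same time and state. *)
have [xz|xn0] := eqVneq x 0.
  rewrite xz leNgt e0/= subr0.
  under eq_bigr do rewrite expf0.
  rewrite sum_idf; apply: (IHul H p t i m.+1 ((e, j) :: o)) => //.
  - by move=> k /st'; rewrite xz addr0.
  - by move: g; rewrite xz addr0.
  - by rewrite /= e0.
have xp : 0 < x by rewrite lt0r xn0.
have GA : genAt s G t = G (inord m).
  apply: genAt_gaps => [|//|k mk]; first by rewrite ltnW// -mn' leq_addr.
  by apply: lt_le_trans (ge _ mk); rewrite ltrDl.
case: (leP e x) => ex.
  have te : t < t + e by rewrite ltrDl.
  have brk : no_brk s t (t + e).
    by apply: (no_brk_gaps st) => k /ge; apply: le_trans; rewrite lerD2l.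
  have := markov_past_step (j := j) HP te brk; rewrite GA => HP'.
  have txE : t + e + (x - e) = t + x by ring.
  rewrite oev_cons (IH _ _ _ _ (x - e) _ _ _ _ _ HP' o0).
  - by rewrite addrAC subrr add0r mulrA.
  - by rewrite subr_ge0.
  - by move=> k km; rewrite (le_trans (st _ km))// ltW.
  - by rewrite /= txE.
  - by apply: measurableI => //; exact: mX.
  - by rewrite addr_ge0// ltW.
have tx : t < t + x by rewrite ltrDl.
have brk : no_brk s t (t + x) by exact: (no_brk_gaps st).
have mHt : measurable (H `&` [set w | X t w = i]).
  by apply: measurableI => //; exact: mX.
have tx0 : 0 <= t + x by rewrite addr_ge0.
(* The break at [t + x] precedes the next observation: the event is split according to the
   unobserved state there. *)
rewrite (@measure_partition _ _ _ P _ _ (fun l => [set w | X (t + x) w = l])); last 4 first.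
- apply: measurableI => //; apply: (measurable_oev mX id (t := t) (o := (e, j) :: o)) => //.
  by rewrite /= e0.
- by move=> l; exact: mX.
- by move=> w _; exists (X (t + x) w).
- by move=> l l' w /= <-.
rewrite mulr_sumr -sumEFin; apply: eq_bigr => l _.
have := markov_past_step (j := l) HP tx brk; rewrite GA => HP'.
rewrite setIAC -[RHS](_ : (p * expf (scalef (t + x - t) (G (inord m))) i l *
    bobs G m.+1 ul ((e - x, j) :: o) l)%:E = _); last first.
  by rewrite addrAC subrr add0r mulrA.
rewrite -(IHul (H `&` [set w | X t w = i]) _ (t + x))//; last by rewrite /= subr_gt0 ex.
have txe : t + x + (e - x) = t + e by ring.
by congr (P (_ `&` _)); rewrite /= txe.
Qed.

End inhomogeneous.

Section homogeneous.
Context {R : realType} {d} {TT : measurableType d} {L E : finType}.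
Variables (P : probability TT R) (Z : R -> TT -> (L * E)%type) (T : @mxf R (L * E)%type).
Hypothesis mZ : forall t i, 0 <= t -> measurable [set w | Z t w = i].

Lemma fdd_homogeneous H p t a (o : seq (R * E)) :
  measurable H -> 0 <= t ->
  markov_past P Z (fun k : 'I_0 => 0) (fun=> T) H p t a -> pos_obs o ->
  P (H `&` [set w | Z t w = a] `&` [set w | oev (fun r => (Z r w).2) t o]) =
  (p * zobs T o a)%:E.
Proof.
elim: o H p t a => [|[e j] o IH] H p t a mH t0 HP.
  move=> _; rewrite (_ : [set w | oev _ _ _] = setT) ?setIT; last exact/seteqP.
  by rewrite (markov_past_measure HP) mulr1.
move=> /= /andP[e0 o0].
have te : t < t + e by rewrite ltrDl.
have te0 : 0 <= t + e by rewrite addr_ge0// ltW.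
have brk : no_brk (fun k : 'I_0 => 0 : R) t (t + e) by case.
have mHt : measurable (H `&` [set w | Z t w = a]).
  by apply: measurableI => //; exact: mZ.
(* The level at the observation time is not observed, so the event is split along it; this produces
   the sum in [zobs]. *)
rewrite (@measure_partition _ _ _ P _ _ (fun k => [set w | Z (t + e) w = (k, j)])); last 4 first.
- apply: measurableI => //; apply: (measurable_oev mZ snd (t := t) (o := (e, j) :: o)) => //.
  by rewrite /= e0.
- by move=> l; exact: mZ.
- by move=> w /= [_ [<- _]]; exists (Z (t + e) w).1; case: (Z _ w).
- by move=> l l' w /= -> [].
rewrite zobs_cons mulr_sumr -sumEFin; apply: eq_bigr => k _.
have := markov_past_step (j := (k, j)) HP te brk; rewrite /genAt addrAC subrr add0r => HP'.
rewrite mulrA -(IH _ _ _ _ mHt te0 HP' o0).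
congr (P _); apply/seteqP; split => w /=.
  by move=> [[h [_ h2]] h3].
by move=> [[h h3] h2]; rewrite h3.
Qed.

End homogeneous.

(** * Path functionals *)

Section conditional_mean.
Context {R : realType} {d} {T : measurableType d}.
Variables (P : probability T R) (A : set T).
Hypothesis mA : measurable A.
Hypothesis PA : (0 < P A)%E.

Let fin_PA : P A \is a fin_num. Proof. exact: fin_num_measure. Qed.

Lemma fine_PA_gt0 : 0 < fine (P A).
Proof. by rewrite -lte_fin fineK. Qed.

Lemma condE_lim (f : nat -> T -> R) g :
  (forall m, measurable_fun setT (f m)) -> (forall m w, 0 <= f m w <= 1) ->
  (forall w, f m w @[m --> \oo] --> g w) ->
  condE P A (f m) @[m --> \oo] --> condE P A g.
Proof.
move=> mf f01 fg; rewrite /condE; apply: cvgM; last exact: cvg_cst.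
have mg : measurable_fun setT g by apply: (@measurable_fun_cvg _ _ _ setT f g).
have mfA m : measurable_fun A (fun w => (f m w)%:E).
  by apply/measurable_EFinP; exact: measurable_funTS.
have mgA : measurable_fun A (fun w => (g w)%:E).
  by apply/measurable_EFinP; exact: measurable_funTS.
have cf : {ae P, forall w, A w -> (f m w)%:E @[m --> \oo] --> (g w)%:E}.
  by apply/aeW => w _; apply: cvg_EFin; [exact: nearW|exact: fg].
have i1 : P.-integrable A (fun=> 1%:E) by exact: finite_measure_integrable_cst.
have bf : {ae P, forall w m, A w -> (`|(f m w)%:E| <= 1%:E)%E}.
  by apply/aeW => w m _; have /andP[a b] := f01 m w; rewrite lee_fin ger0_norm.
have [ig _] := @dominated_convergence _ _ _ P _ mA _ _ _ mfA mgA cf i1 bf.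
by rewrite -{1}(fineK (integrable_fin_num mA ig)) => /fine_cvg.
Qed.

Lemma condE_simple {I : finType} (F : I -> R) (B : I -> set T) :
  (forall k, 0 <= F k) -> (forall k, measurable (B k)) ->
  condE P A (fun w => \sum_k F k * \1_(B k) w) =
  \sum_k F k * (fine (P (A `&` B k)) / fine (P A)).
Proof.
move=> F0 mB; rewrite /condE.
under eq_integral do rewrite -sumEFin.
rewrite ge0_integral_sum//; last 2 first.
- move=> k; apply/measurable_EFinP/measurable_funM; first exact: measurable_cst.
  exact: measurable_indic.
- by move=> k w _; rewrite lee_fin mulr_ge0.
have -> : (\sum_k \int[P]_(w in A) (F k * \1_(B k) w)%:E =
    (\sum_k F k * fine (P (A `&` B k)))%:E)%E.
  rewrite -sumEFin; apply: eq_bigr => k _.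
  under eq_integral do rewrite EFinM.
  rewrite ge0_integralZl//; last 2 first.
  - by apply/measurable_EFinP; exact: measurable_indic.
  - by rewrite lee_fin.
  rewrite integral_indic// setIC EFinM fineK//.
  by apply: fin_num_measure; exact: measurableI.
by rewrite /= mulr_suml; apply: eq_bigr => k _; rewrite mulrA.
Qed.

Lemma measurable_simple {I : finType} (F : I -> R) (B : I -> set T) :
  (forall k, measurable (B k)) ->
  measurable_fun setT (fun w => \sum_k F k * \1_(B k) w).
Proof.
move=> mB; apply: measurable_sum => k; apply: measurable_funM; first exact: measurable_cst.
exact: measurable_indic.
Qed.

Lemma condE_bound (f : T -> R) : measurable_fun setT f ->
  (forall w, 0 <= f w <= 1) -> 0 <= condE P A f <= 1.
Proof.
move=> mf f01; rewrite /condE.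
have I0 : (0 <= \int[P]_(w in A) (f w)%:E)%E.
  by apply: integral_ge0 => w _; have /andP[] := f01 w.
have I1 : (\int[P]_(w in A) (f w)%:E <= P A)%E.
  rewrite -[leRHS]mul1e -integral_cst//; apply: ge0_le_integral => //.
  - by move=> w _; have /andP[] := f01 w.
  - by apply/measurable_EFinP; exact: measurable_funTS.
  - by move=> w _; rewrite lee_fin; have /andP[] := f01 w.
have If : (\int[P]_(w in A) (f w)%:E)%E \is a fin_num.
  by rewrite ge0_fin_numE// (le_lt_trans I1)// ltey_eq fin_PA.
rewrite divr_ge0 ?fine_ge0//= ler_pdivrMr ?fine_PA_gt0// mul1r.
by rewrite -lee_fin !fineK.
Qed.

End conditional_mean.

Fixpoint samples {R : realType} {E : Type} (x : R -> E) (t h : R) (K : nat) : seq E :=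
  if K is K'.+1 then x (t + h) :: samples x (t + h) h K' else [::].

Lemma size_samples {R : realType} {E : Type} (x : R -> E) (t h : R) (K : nat) :
  size (samples x t h K) = K.
Proof. by elim: K t => //= K IH t; rewrite IH. Qed.

Lemma nth_samples {R : realType} {E : Type} (x : R -> E) (t h : R) (K : nat) e k :
  (k < K)%N -> nth e (samples x t h K) k = x (t + k.+1%:R * h).
Proof.
elim: K t k => //= K IH t [|k] kK; first by rewrite mul1r.
by rewrite /= IH//; congr x; rewrite -(natr1 k.+1); ring.
Qed.

Lemma oev_samples {R : realType} {E : finType} (x : R -> E) (h : R) (g : seq E) t :
  oev x t [seq (h, e) | e <- g] <-> samples x t h (size g) = g.
Proof.
elim: g t => //= e g IH t; split=> [[-> /IH ->]//|[xe ge]].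
by split=> //; apply/IH.
Qed.

(** * Path functionals that satisfy the mixture identity *)

Section path_functionals.
Context {R : realType} {E : finType} {n : nat}.
Variables (G : 'I_n.+1 -> @mxf R E) (q : 'I_n -> R).
Hypothesis gG : forall k, is_generator (G k).
Hypothesis q0 : forall k, 0 < q k.
Variables (dX : measure_display) (TX : ('I_n -> R) -> measurableType dX)
  (PX : forall s, probability (TX s) R) (X : forall s, R -> TX s -> E).
Arguments X : clear implicits.
Hypothesis mcX : forall s, incr_pos s -> markov_chain (PX s) (X s) s G /\
  forall i, (0 < PX s [set w | X s 0%R w = i])%E.
Variables (dZ : measure_display) (TZ : measurableType dZ) (PZ : probability TZ R)
  (Z : R -> TZ -> ('I_n.+1 * E)%type).
Hypothesis mcZ : markov_chain PZ Z (fun k : 'I_0 => 0) (fun=> tgen G q).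
Hypothesis Z0 : forall i, (0 < PZ [set w | Z 0%R w = (ord0, i)])%E.

Definition breaks (l : seq R) : 'I_n -> R := cumsum (fun k : 'I_n => nth 0 l k).

Definition meanX i (Phi : (R -> E) -> R) (l : seq R) : R :=
  condE (PX (breaks l)) [set w | X (breaks l) 0 w = i] (fun w => Phi (X (breaks l) ^~ w)).

Definition meanZ i (Phi : (R -> E) -> R) : R :=
  condE PZ [set w | Z 0 w = (ord0, i)] (fun w => Phi (fun r => (Z r w).2)).

Let qs := [seq q k | k <- enum 'I_n].

(** Bundled so as to be stable under pointwise limits. Measurability is required along each process,
    because path space carries no sigma-algebra, and bounds only on right-continuous paths, the only
    ones that occur. *)
Definition mixes (Phi : (R -> E) -> R) : Prop :=
  [/\ forall x, rc_path x -> 0 <= Phi x <= 1,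
      forall s, incr_pos s -> measurable_fun setT (fun w => Phi (X s ^~ w)),
      measurable_fun setT (fun w => Phi (fun r => (Z r w).2)) &
      forall i, exp_mean qs (meanX i Phi) (meanZ i Phi)].

Let size_qs : size qs = n. Proof. by rewrite size_map size_enum_ord. Qed.

Let qs_gt0 : all (fun x => 0 < x) qs.
Proof. by apply/allP => _ /mapP[k _ ->]. Qed.

Lemma breaks_incr l : pos_list qs l -> incr_pos (breaks l).
Proof.
rewrite /pos_list size_qs => /andP[/eqP ln /(all_nthP 0) l0].
have l0' (k : 'I_n) : 0 < nth 0 l k by rewrite l0// ln.
have p (k : 'I_n) : 0 < breaks l k.
  rewrite /breaks /cumsum (bigD1 k)//= ltr_pwDl//.
  by apply: sumr_ge0 => j _; exact: ltW.
split=> // k m km; rewrite /breaks /cumsum [ltRHS](bigID (fun j : 'I_n => (j <= k)%N))/=.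
rewrite [X in _ < X + _](eq_bigl (fun j : 'I_n => (j <= k)%N)); last first.
  by move=> j; rewrite andb_idl// => jk; rewrite (leq_trans jk)// ltnW.
rewrite ltrDl (bigD1 m)/=; last by rewrite leqnn -ltnNge.
by rewrite ltr_pwDl// sumr_ge0// => j _; exact: ltW.
Qed.

Lemma gaps_breaks l : size l = n -> gaps (breaks l) 0 0 l.
Proof.
move=> ln; suff : forall ul m, ul = drop m l -> (m <= n)%N ->
    gaps (breaks l) m (\sum_(0 <= j < m) nth 0 l j) ul.
  by move=> /(_ l 0%N); rewrite drop0 big_geq//; exact.
elim=> [//|x ul IH] m ulE mn /=.
have mn' : (m < n)%N.
  by have := congr1 size ulE; rewrite size_drop ln /=; case: ltnP => //; rewrite -subn_eq0 => /eqP ->.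
have xE : x = nth 0 l m.
  by rewrite -[m]addn0 -nth_drop -ulE.
split.
  move=> k km; rewrite /breaks /cumsum xE -big_nat_recr//=.
  rewrite -(big_mkord (fun j => (j <= k)%N) (fun j => nth 0 l j)).
  rewrite (big_cat_nat (n := m.+1))//= [X in _ + X]big1_seq ?addr0.
    by rewrite big_nat_cond [RHS]big_nat_cond; apply: eq_bigl => j; rewrite km ltnS; case: (j <= m)%N.
  move=> j; rewrite mem_index_iota km => /andP[jm /andP[mj _]].
  by rewrite ltnNge jm in mj.
rewrite xE -big_nat_recr//=; apply: IH => //.
by rewrite -addn1 addnC -drop_drop -ulE /= drop0.
Qed.

Definition cylinder (h : R) (K : nat) (F : seq E -> R) (x : R -> E) : R :=
  F (x 0 :: samples x 0 h K).

Let cyl_set (h : R) (K : nat) {T : Type} (x : R -> T -> E) (a : E * K.-tuple E) : set T :=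
  [set w | x 0 w = a.1 /\ oev (x ^~ w) 0 [seq (h, e) | e <- a.2]].

Let cylinderE h K F {T : Type} (x : R -> T -> E) w : cylinder h K F (x ^~ w) =
  \sum_(a : E * K.-tuple E) F (a.1 :: a.2) * \1_(cyl_set h x a) w :> R.
Proof.
have szs : size (samples (x ^~ w) 0 h K) == K by rewrite size_samples.
rewrite (bigD1 (x 0 w, Tuple szs))//= indicE mem_set ?mulr1; last first.
  by split => //; apply/oev_samples; rewrite size_samples.
rewrite big1 ?addr0// => -[e g] /= eg; rewrite indicE memNset ?mulr0// => -[/= xe /oev_samples].
rewrite size_tuple => gE; move/eqP: eg; apply.
by congr pair => //; apply: val_inj.
Qed.

Let obs_of (h : R) (K : nat) (g : K.-tuple E) : seq (R * E) := [seq (h, e) | e <- g].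

Let pos_obs_of h K (g : K.-tuple E) : 0 < h -> pos_obs (obs_of h g).
Proof. by move=> h0; apply/allP => _ /mapP[e _ ->]. Qed.

Let measurable_cyl_set {S : finType} {d} {T : measurableType d} (x : R -> T -> S)
    (f : S -> E) (h : R) K (a : E * K.-tuple E) :
  (forall t i, 0 <= t -> measurable [set w | x t w = i]) -> 0 < h ->
  measurable (cyl_set h (fun r w => f (x r w)) a).
Proof.
move=> mx h0.
apply: (@measurableI _ _ [set w | f (x 0 w) = a.1]).
  exact: (measurable_comp_fin mx f _ (lexx 0)).
by apply: measurable_oev => //; exact: pos_obs_of.
Qed.

(** Shared by the two processes: [f] is the identity for [X] and the second projection for [Z]. *)
Let ratio_cyl_set {S : finType} {d} {T : measurableType d} (P : probability T R)
    (x : R -> T -> S) (f : S -> E) (s0 : S) (h : R) K (a : E * K.-tuple E) (b : R) :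
  (forall t i, 0 <= t -> measurable [set w | x t w = i]) ->
  (0 < P [set w | x 0%R w = s0])%E ->
  P ([set w | x 0 w = s0] `&` [set w | oev (fun r => f (x r w)) 0 (obs_of h a.2)]) =
    (fine (P [set w | x 0 w = s0]) * b)%:E ->
  fine (P ([set w | x 0 w = s0] `&` cyl_set h (fun r w => f (x r w)) a)) /
    fine (P [set w | x 0 w = s0]) = (a.1 == f s0)%:R * b.
Proof.
move=> mx P0 Pb; have p0 := fine_PA_gt0 (mx 0 s0 (lexx 0)) P0.
have [e|ne] := eqVneq a.1 (f s0).
  rewrite mul1r (_ : _ `&` _ = [set w | x 0 w = s0] `&`
      [set w | oev (fun r => f (x r w)) 0 (obs_of h a.2)]).
    by rewrite Pb /= mulrC mulKf// gt_eqF.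
  apply/seteqP; split => w [/= h1]; first by move=> [].
  by move=> h2; split => //; split => //; rewrite h1 e.
rewrite mul0r (_ : _ `&` _ = set0) ?measure0 ?mul0r//.
apply/seteqP; split => w // [/= h1 [h2 _]].
by move/eqP: ne; apply; rewrite -h2 h1.
Qed.

Lemma mixes_cylinder h K F : 0 < h -> (forall g, 0 <= F g <= 1) -> mixes (cylinder h K F).
Proof.
move=> h0 F01; have F0 g : 0 <= F g by have /andP[] := F01 g.
have [mZ _ _] := mcZ.
split.
- by move=> x _; exact: F01.
- move=> s /mcX[[mX _ _] _].
  rewrite (_ : (fun w => _) = fun w => \sum_(a : E * K.-tuple E) F (a.1 :: a.2) * \1_(cyl_set h (X s) a) w).
    by apply: measurable_simple => a; apply: (measurable_cyl_set id).
  by apply/funext => w; rewrite cylinderE.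
- rewrite (_ : (fun w => _) = fun w => \sum_(a : E * K.-tuple E) F (a.1 :: a.2) *
      \1_(cyl_set h (fun r w => (Z r w).2) a) w).
    by apply: measurable_simple => a; apply: (measurable_cyl_set snd).
  by apply/funext => w; rewrite -cylinderE.
move=> i.
pose c (a : E * K.-tuple E) : R := F (a.1 :: a.2) * (a.1 == i)%:R.
have c0 a : 0 <= c a by rewrite mulr_ge0.
have -> : meanZ i (cylinder h K F) =
    \sum_(a : E * K.-tuple E) c a * zobs (tgen G q) (obs_of h a.2) (ord0, i).
  rewrite /meanZ (_ : (fun w => _) = fun w => \sum_(a : E * K.-tuple E) F (a.1 :: a.2) *
      \1_(cyl_set h (fun r w => (Z r w).2) a) w); last first.
    by apply/funext => w; rewrite -cylinderE.
  rewrite condE_simple//; [|exact: mZ|by move=> a; apply: (measurable_cyl_set snd)].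
  apply: eq_bigr => a _; rewrite -mulrA; congr (_ * _).
  apply: (ratio_cyl_set (f := snd) mZ (Z0 i)).
  rewrite -[X in PZ (X `&` _)]setTI; apply: fdd_homogeneous => //.
  - exact: (markov_past0 mcZ).
  - exact: pos_obs_of.
have h1 : exp_mean qs (fun l => \sum_(a : E * K.-tuple E) c a * bobs G 0 l (obs_of h a.2) i)
    (\sum_(a : E * K.-tuple E) c a * zobs (tgen G q) (obs_of h a.2) (ord0, i)).
  apply: exp_mean_sum => // a; apply: exp_meanZ => //.
  rewrite (_ : ord0 = inord 0); last by apply: val_inj; rewrite /= inordK.
  apply: exp_mean_bobs => //; last exact: pos_obs_of.
  move=> k; rewrite size_qs => kn; rewrite (nth_map (Ordinal kn)) ?size_enum_ord//.
  rewrite add0n -[in RHS](nth_enum_ord (Ordinal kn) kn) -qat_ord//.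
apply: eq_exp_mean h1 => l ql.
have bl := breaks_incr ql; have [mcs X0] := mcX bl; have [mX _ _] := mcs.
move: ql; rewrite /pos_list size_qs => /andP[/eqP ln l0].
rewrite /meanX (_ : (fun w => _) = fun w => \sum_(a : E * K.-tuple E) F (a.1 :: a.2) *
    \1_(cyl_set h (X (breaks l)) a) w); last first.
  by apply/funext => w; rewrite -cylinderE.
rewrite condE_simple//; [|exact: mX|by move=> a; apply: (measurable_cyl_set id)].
apply: eq_bigr => a _; rewrite -mulrA; congr (_ * _); apply/esym.
apply: (ratio_cyl_set (f := id) mX (X0 i)).
rewrite -[X in PX _ (X `&` _)]setTI; apply: fdd_inhomogeneous => //.
- exact: gaps_breaks.
- by apply: sub_all l0 => x; exact: ltW.
- by case: l l0 {ln bl mcs X0 mX} => //= ? ? /andP[].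
- exact: (markov_past0 mcs).
- exact: pos_obs_of.
Qed.

Lemma mixes_lim (Phi : nat -> (R -> E) -> R) (Psi : (R -> E) -> R) :
  (forall m, mixes (Phi m)) ->
  (forall x, rc_path x -> Phi m x @[m --> \oo] --> Psi x) -> mixes Psi.
Proof.
move=> mPhi cPhi.
have rcX s w : incr_pos s -> rc_path (X s ^~ w) by move=> /mcX[[_ + _] _]; exact.
have rcZ w : rc_path (fun r => (Z r w).2).
  have [_ rcZ _] := mcZ; move=> t /(rcZ w)[e e0 h]; exists e => // u /h.
  by move=> ->.
have Psi01 x : rc_path x -> 0 <= Psi x <= 1.
  move=> rx; apply/andP; split.
    apply: (cvgr_to_ge (cPhi x rx)); apply: nearW => m.
    by have [/(_ x rx)/andP[]] := mPhi m.
  apply: (cvgr_to_le (cPhi x rx)); apply: nearW => m.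
  by have [/(_ x rx)/andP[]] := mPhi m.
split=> //.
- move=> s si; apply: (@measurable_fun_cvg _ _ _ _ (fun m w => Phi m (X s ^~ w))).
    by move=> m; have [_ /(_ s si)] := mPhi m.
  by move=> w _; apply: cPhi; exact: rcX.
- apply: (@measurable_fun_cvg _ _ _ _ (fun m w => Phi m (fun r => (Z r w).2))).
    by move=> m; have [] := mPhi m.
  by move=> w _; exact: cPhi.
move=> i.
have [|||I' mI' cI] := @exp_mean_lim _ qs (fun m => meanX i (Phi m))
    (fun m => meanZ i (Phi m)) (meanX i Psi) 1 qs_gt0.
- by move=> m; have [] := mPhi m.
- move=> m l /breaks_incr bl; have [[mX _ _] X0] := mcX bl.
  apply: condE_bound; [exact: mX|exact: X0| |].
    by have [_ /(_ _ bl)] := mPhi m.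
  by move=> w; have [/(_ _ (rcX _ w bl))] := mPhi m.
- move=> l /breaks_incr bl; have [[mX _ _] X0] := mcX bl.
  apply: condE_lim; [exact: mX| | |].
  + by move=> m; have [_ /(_ _ bl)] := mPhi m.
  + by move=> m w; have [/(_ _ (rcX _ w bl))] := mPhi m.
  + by move=> w; apply: cPhi; exact: rcX.
(* [exp_mean_lim] only provides some mean [I']; dominated convergence on the space of [Z] identifies
   it by uniqueness of limits. *)
suff -> : meanZ i Psi = I' by [].
have [mZ _ _] := mcZ.
have cZ : meanZ i (Phi m) @[m --> \oo] --> meanZ i Psi.
  apply: condE_lim; [exact: mZ| | |].
  + by move=> m; have [] := mPhi m.
  + by move=> m w; have [/(_ _ (rcZ w))] := mPhi m.
  + by move=> w; apply: cPhi; exact: rcZ.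
by rewrite -(cvg_lim _ cZ)// (cvg_lim _ cI).
Qed.

End path_functionals.

(** * First passage *)

Section occupation.
Context {R : realType} {E : finType}.
Local Notation mu := (@lebesgue_measure R).
Variables (v : E -> R) (x : R -> E).
Hypothesis rx : rc_path x.

Let M := \sum_e `|v e|.

Let vM e : `|v e| <= M.
Proof. by rewrite /M (bigD1 e)//= lerDl sumr_ge0. Qed.

Let M0 : 0 <= M. Proof. exact: sumr_ge0. Qed.

(** The path is sampled at right endpoints: the sampling time is then to the right of [u] and tends
    to it, so right-continuity makes the value eventually equal to [v (x u)]. *)
Let step (h : R) (N : nat) (u : R) : R :=
  \sum_(k < N) v (x (k.+1%:R * h)) * \1_(`[k%:R * h, k.+1%:R * h[%classic) u.

Let stepE h N u : 0 < h -> 0 <= u < N%:R * h ->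
  step h N u = v (x ((Num.truncn (u / h)).+1%:R * h)).
Proof.
move=> h0 /andP[u0 uN]; set k := Num.truncn _.
have /andP[ku uk] : k%:R <= u / h < k.+1%:R by rewrite truncn_itv// divr_ge0// ltW.
have kN : (k < N)%N.
  by rewrite -(ltr_nat R) (le_lt_trans ku)// ltr_pdivrMr.
rewrite /step (bigD1 (Ordinal kN))//= indicE mem_set ?mulr1; last first.
  by rewrite /= in_itv/= -ler_pdivlMr// ku/= -ltr_pdivrMr.
rewrite big1 ?addr0// => l /negP lk; rewrite indicE memNset ?mulr0//= in_itv/=.
rewrite -ler_pdivlMr// -ltr_pdivrMr// => /truncn_def lE; apply: lk.
by apply/eqP/val_inj; rewrite /= -lE.
Qed.

Let step_cvg (h : R) (l : nat) u : 0 < h -> 0 <= u < l%:R * h ->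
  step (h / r.+1%:R) (l * r.+1) u @[r --> \oo] --> v (x u).
Proof.
move=> h0 /andP[u0 ul]; have [e e0 xe] := rx u0.
apply: cvg_near_cst.
have : \forall r \near \oo, r.+1%:R^-1 < (PosNum (divr_gt0 e0 h0))%:num.
  exact: near_infty_natSinv_lt.
apply: filterS => r /= re.
have r0 : 0 < r.+1%:R :> R by rewrite ltr0n.
set h' := h / r.+1%:R.
have h'0 : 0 < h' by rewrite divr_gt0.
have h'e : h' < e.
  by rewrite /h' mulrC -ltr_pdivlMr.
rewrite stepE//; last first.
  by rewrite u0/= natrM -mulrA (_ : r.+1%:R * h' = h)// mulrC divfK// gt_eqF.
rewrite xe//.
have /andP[ku uk] := truncn_itv (divr_ge0 u0 (ltW h'0)).
apply/andP; split; first by rewrite -ler_pdivrMr// ltW.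
rewrite -natr1 mulrDl mul1r ler_ltD//.
by rewrite -ler_pdivlMr.
Qed.

Let integrable_term (D : set R) (k : nat) h (c : R) : measurable D ->
  mu.-integrable D (fun u => (c * \1_(`[k%:R * h, k.+1%:R * h[%classic) u)%:E).
Proof.
move=> mD; apply: (@integrableS _ _ _ mu setT) => //.
under eq_fun do rewrite EFinM.
apply: integrableZl => //; exact: (integrable_indic_itv _ _ true true).
Qed.

Let integral_step (h : R) N : 0 < h ->
  (\int[mu]_(u in `[0%R, (N%:R * h)%R[) (step h N u)%:E =
   (h * \sum_(k < N) v (x (k.+1%:R * h)))%:E)%E.
Proof.
move=> h0; under eq_integral do rewrite -sumEFin.
rewrite integral_sum//; last by move=> k; exact: integrable_term.
rewrite mulr_sumr -sumEFin; apply: eq_bigr => k _.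
under eq_integral do rewrite EFinM.
rewrite integralZl//; last first.
  apply: (@integrableS _ _ _ mu setT) => //; exact: (integrable_indic_itv _ _ true true).
rewrite integral_indic// (_ : _ `&` _ = `[k%:R * h, k.+1%:R * h[%classic).
  rewrite /= lebesgue_measure_itv/= lte_fin ltr_pM2r// ltr_nat ltnSn -EFinD -EFinM.
  by congr EFin; rewrite -natr1; ring.
apply/seteqP; split => u /=; rewrite !in_itv/=; first by move=> [].
move=> /andP[ku uk]; split; rewrite ?ku ?uk//.
rewrite (le_trans _ ku) ?mulr_ge0 ?(ltW h0)//=.
by rewrite (lt_le_trans uk)// ler_wpM2r ?(ltW h0)// ler_nat.
Qed.

Let measurable_step h N (D : set R) : measurable_fun D (step h N).
Proof.
apply: measurable_sum => k; apply: measurable_funM; first exact: measurable_cst.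
exact: measurable_indic.
Qed.

Lemma measurable_occupation (a : R) : measurable_fun (`[0, a]%classic : set R) (fun u => v (x u)).
Proof.
apply: (@measurable_funS _ _ _ _ (`[0, (Num.truncn a).+1%:R[%classic : set R)).
- exact: measurable_itv.
- move=> u /=; rewrite !in_itv/= => /andP[-> ua] /=.
  by rewrite (le_lt_trans ua)// truncnS_gt.
set l := (Num.truncn a).+1.
apply: (@measurable_fun_cvg _ _ _ _ (fun r => step (1 / r.+1%:R) (l * r.+1))).
  by move=> r; exact: measurable_step.
by move=> u /=; rewrite in_itv/= => ul; apply: step_cvg => //; rewrite mulr1.
Qed.

Lemma integrable_occupation (a b : R) : 0 <= a ->
  mu.-integrable `[a, b] (fun u => (v (x u))%:E).
Proof.
move=> a0; apply: (@measurable_bounded_integrable _ _ _ mu (fun u => v (x u))) => //.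
- by rewrite /= lebesgue_measure_itv/=; case: ifP => // _; rewrite -EFinD ltry.
- apply: (@measurable_funS _ _ _ _ (`[0, b]%classic : set R)) => //; last exact: measurable_occupation.
  by move=> u /=; rewrite !in_itv/= => /andP[au ->]; rewrite (le_trans a0).
- exists M; split; first exact: num_real.
  by move=> K MK u _ /=; rewrite (le_trans (vM _))// ltW.
Qed.

(** The mesh [h] is only subdivided, so every time [l h] stays on all the refined grids and one
    sequence of samples serves all of them. *)
Lemma riemann_cvg (h : R) (l : nat) : 0 < h ->
  h / r.+1%:R * (\sum_(k < l * r.+1) v (x (k.+1%:R * (h / r.+1%:R))))
    @[r --> \oo] --> phi v x (l%:R * h).
Proof.
move=> h0; set a := l%:R * h; have a0 : 0 <= a by rewrite mulr_ge0// ltW.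
have iv : mu.-integrable `[0, a[ (fun u => (v (x u))%:E).
  apply: integrableS (integrable_occupation a (lexx 0)) => //.
  by move=> u /=; rewrite !in_itv/= => /andP[-> /ltW].
have -> : phi v x a = fine (\int[mu]_(u in `[0%R, a[) (v (x u))%:E)%E.
  by rewrite /phi -Rintegral_itv_bndo_bndc.
pose F r u := (step (h / r.+1%:R) (l * r.+1) u)%:E.
have aE r : (l * r.+1)%:R * (h / r.+1%:R) = a.
  by rewrite natrM -mulrA; congr (_ * _); rewrite mulrC divfK// pnatr_eq0.
have IF r : (\int[mu]_(u in `[0%R, a[) F r u = (h / r.+1%:R *
    (\sum_(k < l * r.+1) v (x (k.+1%:R * (h / r.+1%:R)))))%:E)%E.
  by rewrite -integral_step ?aE// divr_gt0.
have mF r : measurable_fun `[0, a[ (F r) by apply/measurable_EFinP; exact: measurable_step.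
have cF : {ae mu, forall u, (`[0, a[%classic : set R) u -> F r u @[r --> \oo] --> (v (x u))%:E}.
  apply/aeW => u /=; rewrite in_itv/= => ua; apply: cvg_EFin; first exact: nearW.
  exact: step_cvg.
have iM : mu.-integrable `[0, a[ (fun=> M%:E).
  apply/integrableP; split; first exact: measurable_cst.
  rewrite integral_cst//= lebesgue_measure_itv/=; case: ifP => _.
    by rewrite -EFinD -EFinM ltry.
  by rewrite mule0 ltry.
have bF : {ae mu, forall u r, (`[0, a[%classic : set R) u -> (`|F r u| <= M%:E)%E}.
  apply/aeW => u r /=; rewrite in_itv/= => ua; rewrite lee_fin stepE ?vM//.
    by rewrite divr_gt0.
  by rewrite aE.
have [_ _] := @dominated_convergence _ _ _ mu _ (measurable_itv `[0, a[) _ _ _ mF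
  (measurable_int mu iv) cF iM bF.
rewrite -(fineK (integrable_fin_num _ iv))// => /fine_cvg; apply: cvg_trans.
by apply: near_eq_cvg; apply: nearW => r /=; rewrite IF.
Qed.

Lemma phi_incr (a b : R) : 0 <= a <= b ->
  phi v x b = phi v x a + (\int[mu]_(u in `]a, b]) v (x u))%R.
Proof.
move=> /andP[a0 ab]; rewrite -(@Rintegral_itvB _ (fun u => v (x u)) (BLeft 0) (BRight b) a).
- by rewrite /phi addrC subrK.
- exact: integrable_occupation.
- by rewrite bnd_simp.
- by rewrite bnd_simp.
Qed.

Let integrable_oc (a b : R) : 0 <= a -> mu.-integrable `]a, b] (EFin \o (fun u => v (x u))).
Proof.
move=> a0; apply: integrableS (integrable_occupation b a0) => //.
by move=> u /=; rewrite !in_itv/= => /andP[/ltW -> ->].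
Qed.

Let measure_oc (a b : R) : a <= b -> fine (mu `]a, b]) = b - a.
Proof.
rewrite lebesgue_measure_itv/= lte_fin le_eqVlt => /predU1P[->|->]//.
by rewrite ltxx subrr.
Qed.

Lemma phi_lipschitz (a b : R) : 0 <= a <= b -> phi v x b - phi v x a <= M * (b - a).
Proof.
move=> /andP[a0 ab]; rewrite (phi_incr (a := a)) ?a0// addrC addKr.
rewrite -(measure_oc ab) -Rintegral_cst//.
apply: le_Rintegral => //.
- exact: integrable_oc.
- apply/integrableP; split; first exact: measurable_cst.
  rewrite integral_cst//= lebesgue_measure_itv/=; case: ifP => _.
    by rewrite -EFinD -EFinM ltry.
  by rewrite mule0 ltry.
- by move=> u _; rewrite (le_trans (ler_norm _)).
Qed.

Lemma phi_affine (a b : R) : 0 <= a <= b -> (forall u, a <= u <= b -> x u = x a) ->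
  phi v x b = phi v x a + v (x a) * (b - a).
Proof.
move=> ab xa; rewrite (phi_incr ab); congr (_ + _); move/andP: ab => [a0 ab].
rewrite -(measure_oc ab) -Rintegral_cst//; apply: eq_Rintegral => u /set_mem /=.
by rewrite in_itv/= => /andP[au ub]; rewrite xa// ub ltW.
Qed.

Lemma phi0 : phi v x 0 = 0.
Proof. by rewrite /phi set_itv1 Rintegral_set1. Qed.

(** Just after [tau] the path is constant, hence [phi] is affine; as [phi] exceeds [t] at times
    arbitrarily close to [tau], its slope is positive, and it exceeds [t] on the whole interval. The
    grid thus cannot miss the passage. *)
Lemma tau_plusP (t : R) : 0 <= t ->
  ((forall r, 0 <= r -> phi v x r <= t) /\ tau_plus v x t = +oo%E) \/
  exists2 tau, [/\ 0 <= tau, tau_plus v x t = tau%:E &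
      forall r, 0 <= r <= tau -> phi v x r <= t] &
    exists2 e, 0 < e & forall r, tau < r < tau + e -> t < phi v x r.
Proof.
move=> t0; set S := [set r | 0 <= r /\ t < phi v x r].
have [[r0 Sr0]|S0] := pselect (exists r, S r); last first.
  left; split.
    by move=> r r0; rewrite leNgt; apply/negP => tr; apply: S0; exists r.
  rewrite /tau_plus (_ : [set r%:E | r in S] = set0) ?ereal_inf0//.
  by apply/seteqP; split => // y [r Sr _]; case: S0; exists r.
right.
have ge0 : (0 <= tau_plus v x t)%E.
  by apply: le_ereal_inf_tmp => _ [r [r00 _] <-]; rewrite lee_fin.
have fin : tau_plus v x t \is a fin_num.
  rewrite ge0_fin_numE// (le_lt_trans _ (ltry r0))//.
  by apply: ereal_inf_lbound; exists r0.
set tau := fine (tau_plus v x t).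
have tauE : tau_plus v x t = tau%:E by rewrite fineK.
have tau0 : 0 <= tau by rewrite -lee_fin -tauE.
have below r : 0 <= r < tau -> phi v x r <= t.
  move=> /andP[r00 rt]; rewrite leNgt; apply/negP => tr.
  have : (tau%:E <= r%:E)%E by rewrite -tauE; apply: ereal_inf_lbound; exists r.
  by rewrite lee_fin leNgt rt.
have at_tau : phi v x tau <= t.
  have [tauz|taup] := eqVneq tau 0; first by rewrite tauz phi0.
  have {}taup : 0 < tau by rewrite lt0r taup.
  rewrite leNgt; apply/negP => ht.
  have M1 : 0 < M + 1 by rewrite ltr_wpDl.
  (* Going back by [y] lowers [phi] by at most [M y], which is less than [phi v x tau - t]; so [phi]
     would exceed [t] before [tau]. Using [M + 1] keeps the denominator positive and the inequality
     strict. *)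
  pose y := Num.min tau ((phi v x tau - t) / (M + 1)).
  have y0 : 0 < y by rewrite lt_min taup divr_gt0// subr_gt0.
  have yt : y <= tau by rewrite ge_min lexx.
  have yM : y * (M + 1) <= phi v x tau - t by rewrite -ler_pdivlMr// ge_min lexx orbT.
  have h1 := @phi_lipschitz (tau - y) tau; rewrite subr_ge0 yt gerBl (ltW y0) in h1.
  have {}h1 := h1 isT.
  have h2 : phi v x (tau - y) <= t by apply: below; rewrite subr_ge0 yt gtrBl.
  move: h1; rewrite (_ : tau - (tau - y) = y); [nra|ring].
have [e e0 xe] := rx tau0.
exists tau; first split => //.
  by move=> r /andP[r00]; rewrite le_eqVlt => /predU1P[->//|rt]; apply: below; rewrite r00.
exists e => // r /andP[tr re].
have : (tau_plus v x t < r%:E)%E by rewrite tauE lte_fin.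
move=> /ereal_inf_lt[_ [r' [r'0 tr'] <-]]; rewrite lte_fin => r'r.
have r't : tau < r'.
  rewrite ltNge; apply/negP; rewrite le_eqVlt => /predU1P[r'E|r'l].
    by move: tr'; rewrite r'E ltNge at_tau.
  by move: tr'; rewrite ltNge below// r'0.
have aff y : tau < y < tau + e -> phi v x y = phi v x tau + v (x tau) * (y - tau).
  move=> /andP[y1 y2]; apply: phi_affine; first by rewrite tau0 ltW.
  by move=> u /andP[u1 u2]; apply: xe; rewrite u1 (le_lt_trans u2).
have A1 := aff r' ltac:(by rewrite r't (lt_trans r'r)).
have A2 := aff r ltac:(by rewrite tr re).
have vp : 0 < v (x tau) by rewrite -(pmulr_lgt0 _ (x := r' - tau)) ?subr_gt0//; nra.
by rewrite A2; rewrite A1 in tr'; nra.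
Qed.

End occupation.

(** * First hit along a grid and its smoothing *)

Section first_hit.
Context {R : realType}.
Implicit Types (w a : nat -> R) (K : nat).

(* If [a] is the indicator of a set of indices, this is the value of [w] at its first
   element; it is used because it is continuous in [a]. *)
Definition hit_sum w a K : R := \sum_(k < K) w k * (a k * \prod_(l < k) (1 - a l)).

Lemma hit_sum_bound w a K : (forall k, 0 <= w k <= 1) -> (forall k, 0 <= a k <= 1) ->
  0 <= hit_sum w a K <= 1.
Proof.
move=> w01 a01.
have p0 k : 0 <= \prod_(l < k) (1 - a l).
  by apply: prodr_ge0 => l _; rewrite subr_ge0; have /andP[] := a01 l.
have t0 k : 0 <= a k * \prod_(l < k) (1 - a l).
  by rewrite mulr_ge0//; have /andP[] := a01 k.
(* The weights form the law of the first success in independent trials with success probabilities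
   [a]. *)
have tot : \sum_(k < K) a k * \prod_(l < k) (1 - a l) = 1 - \prod_(l < K) (1 - a l).
  elim: K => [|K IH]; first by rewrite !big_ord0 subrr.
  by rewrite !big_ord_recr/= IH; ring.
rewrite /hit_sum sumr_ge0/=; last by move=> k _; rewrite mulr_ge0//; have /andP[] := w01 k.
apply: (@le_trans _ _ (\sum_(k < K) a k * \prod_(l < k) (1 - a l))).
  by apply: ler_sum => k _; rewrite ler_piMl//; have /andP[] := w01 k.
by rewrite tot gerBl.
Qed.

Lemma cvg_hit_sum w (a : nat -> nat -> R) b K : (forall k, a r k @[r --> \oo] --> b k) ->
  hit_sum w (a r) K @[r --> \oo] --> hit_sum w b K.
Proof.
move=> ab; apply: cvg_fsum => k; apply: cvgM; first exact: cvg_cst.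
apply: cvgM; first exact: ab.
elim: (k : nat) => [|m IH].
  by under eq_fun do rewrite big_ord0; rewrite big_ord0; exact: cvg_cst.
under eq_fun do rewrite big_ord_recr/=.
by rewrite big_ord_recr/=; apply: cvgM => //; apply: cvgB; [exact: cvg_cst|exact: ab].
Qed.

Lemma hit_sum_none w (b : nat -> bool) K : (forall k, (k < K)%N -> ~~ b k) ->
  hit_sum w (fun k => (b k)%:R) K = 0.
Proof.
move=> bK; rewrite /hit_sum big1// => k _.
by rewrite (negbTE (bK _ (ltn_ord k))) mul0r mulr0.
Qed.

Lemma hit_sum_first w (b : nat -> bool) K k0 : (k0 < K)%N -> b k0 ->
  (forall k, (k < k0)%N -> ~~ b k) -> hit_sum w (fun k => (b k)%:R) K = w k0.
Proof.
move=> kK b0 bk; rewrite /hit_sum (bigD1 (Ordinal kK))//= b0 mul1r.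
rewrite [X in w k0 * X]big1 ?mulr1; last first.
  by move=> l _; rewrite (negbTE (bk _ (ltn_ord l))) subr0.
rewrite big1 ?addr0// => k kk0; have [kl|kg|ke] := ltngtP k k0.
- by rewrite (negbTE (bk _ kl)) mul0r mulr0.
- by rewrite (bigD1 (Ordinal kg))//= b0 subrr mul0r !mulr0.
- by move/eqP: kk0; case; apply: val_inj.
Qed.

End first_hit.

Section soft_indicator.
Context {R : realType}.

(** The exponent is [-2p] times the positive part of [y - t]: the value is exactly 0 for [y <= t],
    so the limit in [p] is the strict indicator. *)
Definition soft (t : R) (p : nat) (y : R) : R := 1 - expR (- (p%:R * (`|y - t| + (y - t)))).

Lemma soft01 t p y : 0 <= soft t p y <= 1.
Proof.
rewrite /soft subr_ge0 gerBl expR_ge0 andbT expR_le1 oppr_le0 mulr_ge0//.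
by rewrite -lerBlDr sub0r -normrN ler_norm.
Qed.

Lemma continuous_soft t p : continuous (soft t p).
Proof.
move=> y; apply: cvgB; first exact: cvg_cst.
apply: continuous_cvg; first exact: continuous_expR.
apply: cvgN; apply: cvgM; first exact: cvg_cst.
have c : (fun y => y - t) @ y --> y - t by apply: cvgB; [exact: cvg_id|exact: cvg_cst].
by apply: cvgD => //; exact: cvg_norm.
Qed.

Lemma cvg_soft t y : soft t p y @[p --> \oo] --> ((t < y)%R%:R : R).
Proof.
case: (ltP t y) => ty.
  have c0 : 0 < `|y - t| + (y - t) by rewrite ltr_wpDl// subr_gt0.
  rewrite -[X in _ --> X]subr0; apply: cvgB; first exact: cvg_cst.
  under eq_fun do rewrite -mulrN expRM_natl.
  by apply: cvg_expr; rewrite ger0_norm ?expR_ge0// expR_lt1 oppr_lt0.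
rewrite (_ : (fun p => soft t p y) = fun=> 0); first exact: cvg_cst.
by apply/funext => p; rewrite /soft ler0_norm ?subr_le0// addNr mulr0 oppr0 expR0 subrr.
Qed.

End soft_indicator.

Section discounted_passage.
Context {R : realType} {E : finType}.
Variables (v : E -> R) (c t : R) (j : E).
Hypothesis c0 : 0 < c.
Hypothesis t0 : 0 <= t.

Let mesh (m : nat) : R := m.+1%:R^-1.
(** With mesh [1 / m.+1] this many points cover the times before [m.+1]: the grid is refined and its
    range extended together. *)
Let horizon (m : nat) : nat := (m.+1 * m.+1)%N.

Let mesh_gt0 m : 0 < mesh m. Proof. by rewrite invr_gt0 ltr0n. Qed.

Let weight (h : R) (x : nat -> E) (k : nat) : R := expR (- (c * (k%:R * h))) * (x k == j)%:R.

Let weight01 h x k : 0 <= h -> 0 <= weight h x k <= 1.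
Proof.
move=> h0; apply: mulr01; last exact: bool01.
by rewrite expR_ge0 expR_le1 oppr_le0 !mulr_ge0// ltW.
Qed.

Definition disc_grid m (x : R -> E) : R :=
  hit_sum (weight (mesh m) (fun k => x (k%:R * mesh m)))
    (fun k => (t < phi v x (k%:R * mesh m))%R%:R) (horizon m).

Definition disc_soft m p (x : R -> E) : R :=
  hit_sum (weight (mesh m) (fun k => x (k%:R * mesh m)))
    (fun k => soft t p (phi v x (k%:R * mesh m))) (horizon m).

(** [s] lists the samples at step [mesh m / r.+1] from time 0 on, so index [k * r.+1] is time
    [k * mesh m]. The default [j] of [nth] only matters for lists that are too short. *)
Definition disc_cyl m p r (s : seq E) : R :=
  hit_sum (weight (mesh m) (fun k => nth j s (k * r.+1)))
    (fun k => soft t p (mesh m / r.+1%:R * \sum_(i < k * r.+1) v (nth j s i.+1)))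
    (horizon m).

Lemma disc_cyl01 m p r s : 0 <= disc_cyl m p r s <= 1.
Proof.
by apply: hit_sum_bound => k; [exact/weight01/ltW/mesh_gt0|exact: soft01].
Qed.

Lemma disc_cyl_cvg m p (x : R -> E) : rc_path x ->
  cylinder (mesh m / r.+1%:R) (horizon m * r.+1) (disc_cyl m p r) x @[r --> \oo] -->
  disc_soft m p x.
Proof.
move=> rx.
have nthE r i : (i <= horizon m * r.+1)%N ->
    nth j (x 0 :: samples x 0 (mesh m / r.+1%:R) (horizon m * r.+1)) i =
    x (i%:R * (mesh m / r.+1%:R)).
  case: i => [|i] im; first by rewrite mul0r.
  by rewrite -nth_behead nth_samples// add0r.
have -> : (fun r => cylinder (mesh m / r.+1%:R) (horizon m * r.+1) (disc_cyl m p r) x) =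
    fun r => hit_sum (weight (mesh m) (fun k => x (k%:R * mesh m)))
      (fun k => soft t p (mesh m / r.+1%:R * \sum_(i < k * r.+1) v (x (i.+1%:R * (mesh m / r.+1%:R)))))
      (horizon m).
  apply/funext => r; rewrite /cylinder /disc_cyl /hit_sum; apply: eq_bigr => k _.
  have kr l : (l <= k)%N -> (l * r.+1 <= horizon m * r.+1)%N.
    by move=> lk; rewrite leq_mul2r/= (leq_trans lk)// ltnW.
  have sE l : (l <= k)%N ->
      \sum_(i < l * r.+1) v (nth j (x 0 :: samples x 0 (mesh m / r.+1%:R) (horizon m * r.+1)) i.+1) =
      \sum_(i < l * r.+1) v (x (i.+1%:R * (mesh m / r.+1%:R))).
    move=> lk; apply: eq_bigr => i _; rewrite nthE//.
    by apply: leq_trans (kr _ lk).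
  have xE : (k * r.+1)%:R * (mesh m / r.+1%:R) = k%:R * mesh m.
    by rewrite natrM -mulrA; congr (_ * _); rewrite mulrC divfK// pnatr_eq0.
  rewrite /weight nthE ?kr// xE.
  rewrite sE//; congr (_ * (_ * _)); apply: eq_bigr => l _.
  by rewrite sE// ltnW.
apply: cvg_hit_sum => k.
apply: (@continuous_cvg _ _ _ _ _ _ (soft t p)); first exact: continuous_soft.
exact/riemann_cvg/mesh_gt0.
Qed.

Lemma disc_soft_cvg m (x : R -> E) : disc_soft m p x @[p --> \oo] --> disc_grid m x.
Proof. by apply: cvg_hit_sum => k; exact: cvg_soft. Qed.

Lemma disc_grid_cvg (x : R -> E) : rc_path x -> disc_grid m x @[m --> \oo] --> disc c v x t j.
Proof.
move=> rx; rewrite /disc.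
have [[le ->]|[tau [tau0 -> le] [e e0 gt]]] := tau_plusP v rx t0.
  apply: cvg_near_cst; apply: nearW => m; apply: hit_sum_none => k _.
  by rewrite -leNgt le// mulr_ge0// ltW.
have [e' e'0 xe] := rx tau tau0.
(* the first grid point after [tau] *)
pose k0 m := (Num.truncn (tau * m.+1%:R)).+1.
have k0P m : tau < (k0 m)%:R * mesh m <= tau + mesh m.
  have m0 : 0 < m.+1%:R :> R by rewrite ltr0n.
  have /andP[a b] := truncn_itv (mulr_ge0 tau0 (ltW m0)).
  rewrite /mesh ltr_pdivlMr// b/= ler_pdivrMr// mulrDl mulVf ?gt_eqF//.
  by rewrite /k0 -natr1 lerD2r.
have k0l m k : (k < k0 m)%N -> k%:R * mesh m <= tau.
  have m0 : 0 < m.+1%:R :> R by rewrite ltr0n.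
  rewrite /mesh ler_pdivrMr// ltnS => kk.
  by rewrite (le_trans _ (proj1 (andP (truncn_itv (mulr_ge0 tau0 (ltW m0))))))// ler_nat.
have small (d : R) : 0 < d -> \forall m \near \oo, mesh m < d.
  by move=> d0; exact: (near_infty_natSinv_lt (PosNum d0)).
have gridE : \forall m \near \oo,
    disc_grid m x = expR (- (c * ((k0 m)%:R * mesh m))) * (x tau == j)%:R.
  near=> m.
  have /andP[k1 k2] := k0P m.
  have me : mesh m < e by near: m; exact: small.
  have me' : mesh m < e' by near: m; exact: small.
  (* Since [mesh m <= 1], this keeps the first grid point beyond [tau] within the horizon. *)
  have mt : tau + 1 < m.+1%:R.
    rewrite (@le_lt_trans _ _ m%:R)//; last by rewrite ltr_nat.
    by near: m; exact: nbhs_infty_ger.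
  rewrite /disc_grid (@hit_sum_first _ _ (fun k => t < phi v x (k%:R * mesh m)) _ (k0 m)).
  - rewrite /weight (_ : x ((k0 m)%:R * mesh m) = x tau)//.
    by rewrite xe// ltW//= (le_lt_trans k2)// ltrD2l.
  - rewrite -(ltr_nat R) natrM -ltr_pdivrMr ?ltr0n//.
    rewrite (le_lt_trans k2)// (le_lt_trans _ mt)// lerD2l /mesh.
    by rewrite invf_le1 ?ltr0n// ler1n.
  - by apply: gt; rewrite k1/= (le_lt_trans k2)// ltrD2l.
  - move=> k kk; rewrite -leNgt le// k0l// andbT mulr_ge0// ltW//.
apply: cvg_trans (near_eq_cvg (f := fun m => expR (- (c * ((k0 m)%:R * mesh m))) * (x tau == j)%:R) _) _.
  by apply: filterS gridE => m ->.
apply: cvgM; last exact: cvg_cst.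
apply: (@continuous_cvg _ _ _ _ _ _ expR); first exact: continuous_expR.
apply: cvgN; apply: cvgM; first exact: cvg_cst.
apply: (@squeeze_cvgr _ _ _ _ (fun=> tau) (fun m => tau + mesh m)).
- by apply: nearW => m; have /andP[a b] := k0P m; rewrite ltW.
- exact: cvg_cst.
- rewrite -[X in _ --> X]addr0; apply: cvgD; first exact: cvg_cst.
  exact: cvg_harmonic.
Unshelve. all: by end_near. Qed.

End discounted_passage.

(** * The Laplace transform of the discounted passage *)

Lemma wsumE {R : realType} (qs l : seq R) :
  wsum qs l = \sum_(k < size qs) nth 0 qs k * nth 0 l k.
Proof.
elim: qs l => [|r qs IH] [|x l] /=; rewrite ?big_ord0//.
  by rewrite big1// => k _; rewrite nth_nil mulr0.
by rewrite big_ord_recl/= IH.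
Qed.

Section laplace.
Context {R : realType} {E : finType} {n : nat}.
Variables (G : 'I_n.+1 -> @mxf R E) (v : E -> R) (c : R).
Hypothesis gG : forall k, is_generator (G k).
Hypothesis c0 : 0 < c.
Variables (dX : measure_display) (TX : ('I_n -> R) -> measurableType dX)
  (PX : forall s, probability (TX s) R) (X : forall s, R -> TX s -> E).
Arguments X : clear implicits.
Hypothesis mcX : forall s, incr_pos s -> markov_chain (PX s) (X s) s G /\
  forall i, (0 < PX s [set w | X s 0%R w = i])%E.
Variables (dZ : measure_display) (TZ : ('I_n -> R) -> measurableType dZ)
  (PZ : forall q, probability (TZ q) R) (Z : forall q, R -> TZ q -> ('I_n.+1 * E)%type).
Arguments Z : clear implicits.
Hypothesis mcZ : forall q : 'I_n -> R, (forall k, 0 < q k) ->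
  markov_chain (PZ q) (Z q) (fun k : 'I_0 => 0) (fun _ => tgen G q) /\
  forall i, (0 < PZ q [set w | Z q 0%R w = (ord0, i)])%E.

(** Both claims of the theorem are instances, at [t = 0] and at [t > 0]. The proof peels off the
    limits from the outermost: mesh [m], smoothing [p], subdivision [r]. *)
Lemma laplace_disc t i j : 0 <= t ->
  laplace_eq
    (fun u => condE (PX (cumsum u)) [set w | X (cumsum u) 0 w = i]
                (fun w => disc c v (fun r => X (cumsum u) r w) t j))
    (fun q => (\prod_k (q k)^-1) *
       condE (PZ q) [set w | Z q 0 w = (ord0, i)]
             (fun w => disc c v (fun r => (Z q r w).2) t j)).
Proof.
move=> t0 q q0; have [mq Z0] := mcZ q0.
have mix : mixes q PX X (PZ q) (Z q) (fun x => disc c v x t j).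
  apply: (mixes_lim q0 mcX mq (Phi := disc_grid v c t j)); last first.
    by move=> x; exact: disc_grid_cvg.
  move=> m; apply: (mixes_lim q0 mcX mq (Phi := disc_soft v c t j m)); last first.
    by move=> x _; exact: disc_soft_cvg.
  move=> p; apply: (mixes_lim q0 mcX mq (Phi := fun r =>
    cylinder (m.+1%:R^-1 / r.+1%:R) (m.+1 * m.+1 * r.+1) (disc_cyl v c t j m p r))); last first.
    by move=> x rx; exact: disc_cyl_cvg.
  move=> r; apply: (mixes_cylinder gG q0 mcX mq Z0); last by move=> s; exact: disc_cyl01.
  by rewrite divr_gt0 ?invr_gt0 ?ltr0n.
have [_ _ _ /(_ i) mixi] := mix.
set qs := [seq q k | k <- enum 'I_n] in mixi.
have szq : size qs = n by rewrite size_map size_enum_ord.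
have qs0 : all (fun x => 0 < x) qs by apply/allP => _ /mapP[k _ ->].
have := iint_exp_mean qs0 ler01 mixi.
rewrite mul1r big_map big_enum/= szq => <-.
congr iint; apply/funext => l; congr EFin; rewrite mul1r; congr (_ * expR (- _)).
rewrite wsumE szq; apply: eq_bigr => k _; congr (_ * _).
by rewrite (nth_map k) ?size_enum_ord// nth_ord_enum.
Qed.

End laplace.
Unset Implicit Arguments.

Theorem theorem3p7 (R : realType) (E : finType) (n : nat)
  (G : 'I_n.+1 -> E -> E -> R) (v : E -> R) (c : R)
  (dX : measure_display) (TX : ('I_n -> R) -> measurableType dX)
  (PX : forall s, probability (TX s) R) (X : forall s, R -> TX s -> E)
  (dZ : measure_display) (TZ : ('I_n -> R) -> measurableType dZ)
  (PZ : forall q, probability (TZ q) R) (Z : forall q, R -> TZ q -> ('I_n.+1 * E)%type) :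
  (forall k, is_generator (G k)) ->
  (forall i, v i != 0) ->
  0 < c ->
  (forall s, incr_pos s ->
     markov_chain (PX s) (X s) s G /\
     forall i, (0 < PX s [set w | X s 0%R w = i])%E) ->
  (forall q : 'I_n -> R, (forall k, 0 < q k) ->
     markov_chain (PZ q) (Z q) (fun k : 'I_0 => 0) (fun _ => tgen G q) /\
     forall i, (0 < PZ q [set w | Z q 0%R w = (ord0, i)])%E) ->
  (forall i j, v i < 0 -> 0 < v j ->
     laplace_eq
       (fun u => condE (PX (cumsum u)) [set w | X (cumsum u) 0 w = i]
                   (fun w => disc c v (fun r => X (cumsum u) r w) 0 j))
       (fun q => (\prod_k (q k)^-1) *
          condE (PZ q) [set w | Z q 0 w = (ord0, i)]
                (fun w => disc c v (fun r => (Z q r w).2) 0 j))) /\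
  (forall t, 0 < t -> forall i j, 0 < v i -> 0 < v j ->
     laplace_eq
       (fun u => condE (PX (cumsum u)) [set w | X (cumsum u) 0 w = i]
                   (fun w => disc c v (fun r => X (cumsum u) r w) t j))
       (fun q => (\prod_k (q k)^-1) *
          condE (PZ q) [set w | Z q 0 w = (ord0, i)]
                (fun w => disc c v (fun r => (Z q r w).2) t j))).
Proof.
move=> gG _ c0 mcX mcZ; split=> [i j _ _|t t0 i j _ _].
- exact: (laplace_disc v gG c0 mcX mcZ i j (lexx 0)).
- exact: (laplace_disc v gG c0 mcX mcZ i j (ltW t0)).
Qed.
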